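(* Consider a nonlinear discrete-time system $x^{i,+}=f^{i}(x,u)$, $i=1,\dots,n$, with $\dim(x)=n$, $\dim(u)=m$, smooth $f^i$, and $\mathrm{rank}(\partial_{(x,u)}f)=n$, locally around an equilibrium $(x_0,u_0)$. Let $E_0\subset E_1\subset\cdots\subset E_{\bar k-1}$ be the sequence of distributions on $\mathcal{X}\times\mathcal{U}$ generated by Algorithm A and let $P_{\bar k}\subset P_{\bar k-1}\subset\cdots\subset P_1$ be the sequence of codistributions on $\mathcal{X}\times\mathcal{U}$ generated by Algorithm B (both algorithms are defined in the context). Then for $k=1,\ldots,\bar k$ the two sequences are related by $$P_k=E_{k-1}^{\perp}.$$
   Context: Setting. The map $f$ is regarded as a map $f:\mathcal{X}\times\mathcal{U}\to\mathcal{X}^+$ from a manifold with coordinates $(x,u)$ to a manifold with coordinates $x^+$ ($\dim\mathcal{X}^+=n$). The map $\pi:\mathcal{X}\times\mathcal{U}\to\mathcal{X}^+$ is defined by $x^{i,+}=x^i$, $i=1,\dots,n$. An equilibrium is a point with $x_0=f(x_0,u_0)$. All statements are local, in a suitable (sufficiently small) neighborhood of an equilibrium. All distributions and codistributions that occur are assumed to be smooth and of locally constant dimension. $\perp$ denotes the annihilator, e.g. $E^\perp$ is the codistribution of all 1-forms $\omega$ with $\omega(v)=0$ for all $v\in E$. Adapted coordinates. Since $f$ is a submersion, one can choose functions $h^j$ such that $\theta^i=f^i(x,u)$, $i=1,\dots,n$, $\xi^j=h^j(x,u)$, $j=1,\dots,m$, are local coordinates on $\mathcal{X}\times\mathcal{U}$.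 Projectability. A vector field on $\mathcal{X}\times\mathcal{U}$ is called projectable (w.r.t. $f$) if in adapted coordinates it has the form $v=a^i(\theta)\partial_{\theta^i}+b^j(\theta,\xi)\partial_{\xi^j}$, i.e. the $a^i$ do not depend on $\xi$; then $f_*(v)=a^i(x^+)\partial_{x^{i,+}}$ is a well-defined vector field on $\mathcal{X}^+$. A distribution on $\mathcal{X}\times\mathcal{U}$ is called projectable if it admits a basis of projectable vector fields; its pushforward $f_*(D)$ is the distribution on $\mathcal{X}^+$ spanned by the pushforwards of these. Invariance. A codistribution $P$ is called invariant w.r.t. a distribution $D$ if $L_v\omega\in P$ for all 1-forms $\omega\in P$ and all vector fields $v\in D$ ($L_v$ is the Lie derivative). Backward-shift. For 1-forms of the form $\omega_i(f(x,u))\,\mathrm{d}f^i$, the backward-shift is $\delta^{-1}(\omega_i(f(x,u))\,\mathrm{d}f^i)=\omega_i(x)\,\mathrm{d}x^i$; the backward-shift of a codistribution spanned by such 1-forms is the codistribution spanned by the backward-shifts of these basis 1-forms. Algorithm A. Start with $E_0=\mathrm{span}\{\partial_u\}$ on $\mathcal{X}\times\mathcal{U}$ and repeat for $k\ge1$: (1) determine the largest projectable subdistribution $D_{k-1}\subseteq E_{k-1}$; (2) compute the pushforward $\Delta_k=f_*(D_{k-1})$ on $\mathcal{X}^+$; (3) set $E_k=\pi_*^{-1}(\Delta_k)$, i.e. the distribution of all tangent vectors $v$ on $\mathcal{X}\times\mathcal{U}$ with $\pi_*(v)\in\Delta_k$ (equivalently: replace $x^+$ by $x$ in a basis of $\Delta_k$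 and add $\partial_{u^1},\dots,\partial_{u^m}$). Stop if $\dim(E_{\bar k})=\dim(E_{\bar k-1})$ for some step $\bar k$. Algorithm B. Start with $P_1=\mathrm{span}\{\mathrm{d}x\}$ on $\mathcal{X}\times\mathcal{U}$ and repeat for $k\ge1$: (1) compute $P_k\cap\mathrm{span}\{\mathrm{d}f\}$; (2) determine the smallest codistribution $P_{k+1}^+$ which is invariant w.r.t. the distribution $\mathrm{span}\{\mathrm{d}f\}^\perp$ and contains $P_k\cap\mathrm{span}\{\mathrm{d}f\}$ (it has a basis of 1-forms of the form $\omega_i(f(x,u))\,\mathrm{d}f^i$); (3) set $P_{k+1}=\delta^{-1}(P_{k+1}^+)$. Stop if $P_{\bar k+1}=P_{\bar k}$ for some step $\bar k$. The same symbol $\bar k$ is used for the stopping step of both algorithms. *)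

(* Defs.v *)
(* Everything lives in local coordinates: a point of the
   N-dimensional manifold is a row vector z : 'rV[R]_N, and for
   X x U (N = n + m) z = row_mx x u.  "Locally" means: for all z in some
   neighborhood of the reference point, written \forall z \near z0; functions
   and (co)distributions are total but only their germs at z0 matter.

   Tangent vectors are rows, covectors are columns, and w(v) = v *m w.  In the
   row convention of the library, 'J g z : 'M_(N, p) represents the tangent
   map of g : 'rV_N -> 'rV_p by v |-> v *m 'J g z, and its i-th column is the
   differential dg^i. *)
From HB Require Import structures.
From mathcomp Require Import all_boot all_order all_algebra.
From mathcomp Require Import all_classical all_reals all_analysis.

Set Implicit Arguments.
Unset Strict Implicit.
Unset Printing Implicit Defensive.

Import Order.TTheory GRing.Theory Num.Theory.
Import numFieldNormedType.Exports.

Local Open Scope classical_set_scope.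
Local Open Scope ring_scope.

Section Geometry.
Variable R : realType.

Definition iter_derive (V W : normedModType R) (s : seq V) (g : V -> W) :
    V -> W :=
  foldr (fun v h z => 'D_v h z) g s.

(* C^oo on a neighborhood of z0: iterated directional derivatives of every
   order exist and are differentiable there. *)
Definition smooth_near (V W : normedModType R) (z0 : V) (g : V -> W) : Prop :=
  \forall z \near z0, forall s : seq V, differentiable (iter_derive s g) z.

Definition tdistribution (N : nat) := 'rV[R]_N -> {vspace 'rV[R]_N}.
Definition codistribution (N : nat) := 'rV[R]_N -> {vspace 'cV[R]_N}.

(* Smooth and of constant dimension near z0, for a field of subspaces of
   'M_(p, q): p = 1 for distributions, q = 1 for codistributions. *)
Definition regular_near (N p q : nat) (z0 : 'rV[R]_N)
    (D : 'rV[R]_N -> {vspace 'M[R]_(p, q)}) : Prop :=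
  (exists (r : nat) (X : 'I_r -> 'rV[R]_N -> 'M[R]_(p, q)),
     (forall i, smooth_near z0 (X i)) /\
     \forall z \near z0, D z = <<[seq X i z | i : 'I_r]>>%VS) /\
  (\forall z \near z0, \dim (D z) = \dim (D z0)).

Definition sub_near (N p q : nat) (z0 : 'rV[R]_N)
    (D D' : 'rV[R]_N -> {vspace 'M[R]_(p, q)}) : Prop :=
  \forall z \near z0, (D z <= D' z)%VS.

Definition ann (N : nat) (E : {vspace 'rV[R]_N}) : {vspace 'cV[R]_N} :=
  (\bigcap_(v <- vbasis E) lker (linfun (@mulmx R 1 N 1 v)))%VS.

Definition coann (N : nat) (P : {vspace 'cV[R]_N}) : {vspace 'rV[R]_N} :=
  (\bigcap_(w <- vbasis P) lker (linfun (@mulmxr R 1 N 1 w)))%VS.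

Lemma mem_ann (N : nat) (E : {vspace 'rV[R]_N}) (w : 'cV[R]_N) :
  w \in ann E <-> forall v, v \in E -> v *m w = 0.
Proof.
rewrite /ann; split=> [wE v vE|wE].
  rewrite (coord_vbasis vE) mulmx_suml big1// => i _.
  rewrite -scalemxAl; apply/eqP; rewrite scaler_eq0; apply/orP; right.
  have vi : (vbasis E)`_i \in (vbasis E : seq _).
    by rewrite mem_nth// size_tuple.
  have: w \in lker (linfun (@mulmx R 1 N 1 (vbasis E)`_i)).
    by move: wE; rewrite (big_rem _ vi)/= memv_cap => /andP[].
  by rewrite memv_ker lfunE.
rewrite big_seq; elim/big_ind: _ => [|U V wU wV|v vE].
- exact: memvf.
- by rewrite memv_cap wU wV.
- by rewrite memv_ker lfunE/= wE// vbasis_mem.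
Qed.

Lemma mem_coann (N : nat) (P : {vspace 'cV[R]_N}) (v : 'rV[R]_N) :
  v \in coann P <-> forall w, w \in P -> v *m w = 0.
Proof.
rewrite /coann; split=> [vP w wP|vP].
  rewrite (coord_vbasis wP) mulmx_sumr big1// => i _.
  rewrite -scalemxAr; apply/eqP; rewrite scaler_eq0; apply/orP; right.
  have wi : (vbasis P)`_i \in (vbasis P : seq _).
    by rewrite mem_nth// size_tuple.
  have: v \in lker (linfun (@mulmxr R 1 N 1 (vbasis P)`_i)).
    by move: vP; rewrite (big_rem _ wi)/= memv_cap => /andP[].
  by rewrite memv_ker lfunE.
rewrite big_seq; elim/big_ind: _ => [|U V vU vV|w wP].
- exact: memvf.
- by rewrite memv_cap vU vV.
- by rewrite memv_ker lfunE/= vP// vbasis_mem.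
Qed.

(* span {dg} *)
Definition dspan (N p : nat) (g : 'rV[R]_N -> 'rV[R]_p) : codistribution N :=
  fun z => <<[seq col i ('J g z) | i : 'I_p]>>%VS.

(* the pullback (w_i o g) dg^i of the 1-form w_i dy^i *)
Definition pullback_form (N p : nat) (g : 'rV[R]_N -> 'rV[R]_p)
    (w : 'rV[R]_p -> 'cV[R]_p) : 'rV[R]_N -> 'cV[R]_N :=
  fun z => 'J g z *m w (g z).

(* g_*^{-1}(Delta) = { v | g_* v \in Delta } *)
Definition preimage_dist (N p : nat) (g : 'rV[R]_N -> 'rV[R]_p)
    (Delta : tdistribution p) : tdistribution N :=
  fun z => (linfun (@mulmxr R 1 N p ('J g z)) @^-1: Delta (g z))%VS.

(* (L_v w)_j = v^i d_i w_j + w_i d_j v^i *)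
Definition lie_derivative (N : nat) (v : 'rV[R]_N -> 'rV[R]_N)
    (w : 'rV[R]_N -> 'cV[R]_N) : 'rV[R]_N -> 'cV[R]_N :=
  fun z => 'D_(v z) w z + 'J v z *m w z.

Definition invariant_codist (N : nat) (z0 : 'rV[R]_N) (P : codistribution N)
    (D : tdistribution N) : Prop :=
  forall (v : 'rV[R]_N -> 'rV[R]_N) (w : 'rV[R]_N -> 'cV[R]_N),
    smooth_near z0 v -> smooth_near z0 w ->
    (\forall z \near z0, v z \in D z) -> (\forall z \near z0, w z \in P z) ->
    \forall z \near z0, lie_derivative v w z \in P z.

Definition smallest_invariant (N : nat) (z0 : 'rV[R]_N) (D : tdistribution N)
    (Q P : codistribution N) : Prop :=
  [/\ regular_near z0 P, invariant_codist z0 P D, sub_near z0 Q P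
    & forall P' : codistribution N, regular_near z0 P' -> invariant_codist z0 P' D ->
        sub_near z0 Q P' -> sub_near z0 P P'].

(* Phi is a local diffeomorphism at z0, i.e. a system of local coordinates *)
Definition local_coordinates (N : nat) (z0 : 'rV[R]_N)
    (Phi : 'rV[R]_N -> 'rV[R]_N) : Prop :=
  smooth_near z0 Phi /\
  exists Psi : 'rV[R]_N -> 'rV[R]_N,
    [/\ smooth_near (Phi z0) Psi,
        \forall z \near z0, Psi (Phi z) = z
      & \forall y \near Phi z0, Phi (Psi y) = y].

End Geometry.

Section System.
Variables (R : realType) (n m : nat).
Variables (f : 'rV[R]_(n + m) -> 'rV[R]_n) (z0 : 'rV[R]_(n + m)).

Definition pi_map : 'rV[R]_(n + m) -> 'rV[R]_n := fun z => lsubmx z.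

(* (theta, xi) = (f, h) *)
Definition with_coords (h : 'rV[R]_(n + m) -> 'rV[R]_m) :
    'rV[R]_(n + m) -> 'rV[R]_(n + m) :=
  fun z => row_mx (f z) (h z).

(* v is projectable and f_* v = a: in some adapted coordinates
   (theta, xi) = (f, h), v = a^i(theta) d_theta^i + b^j(theta, xi) d_xi^j.
   The components of v in the coordinates Phi are v *m 'J Phi. *)
Definition pushforward_field (v : 'rV[R]_(n + m) -> 'rV[R]_(n + m))
    (a : 'rV[R]_n -> 'rV[R]_n) : Prop :=
  [/\ smooth_near z0 v, smooth_near (f z0) a
    & exists (h : 'rV[R]_(n + m) -> 'rV[R]_m)
             (b : 'rV[R]_(n + m) -> 'rV[R]_m),
        [/\ local_coordinates z0 (with_coords h),
            smooth_near (with_coords h z0) b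
          & \forall z \near z0, v z *m 'J (with_coords h) z
                                = row_mx (a (f z)) (b (with_coords h z))]].

Definition projectable_field (v : 'rV[R]_(n + m) -> 'rV[R]_(n + m)) : Prop :=
  exists a, pushforward_field v a.

Definition projectable (D : tdistribution R (n + m)) : Prop :=
  exists (r : nat) (v : 'I_r -> 'rV[R]_(n + m) -> 'rV[R]_(n + m)),
    (forall i, projectable_field (v i)) /\
    \forall z \near z0, basis_of (D z) [seq v i z | i : 'I_r].

(* Delta = f_*(D) *)
Definition pushforward_dist (D : tdistribution R (n + m))
    (Delta : tdistribution R n) : Prop :=
  exists (r : nat) (v : 'I_r -> 'rV[R]_(n + m) -> 'rV[R]_(n + m))
         (a : 'I_r -> 'rV[R]_n -> 'rV[R]_n),
    [/\ forall i, pushforward_field (v i) (a i),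
        \forall z \near z0, basis_of (D z) [seq v i z | i : 'I_r]
      & \forall y \near f z0, Delta y = <<[seq a i y | i : 'I_r]>>%VS].

Definition largest_projectable (E D : tdistribution R (n + m)) : Prop :=
  [/\ regular_near z0 D, projectable D, sub_near z0 D E
    & forall D' : tdistribution R (n + m), regular_near z0 D' ->
        projectable D' -> sub_near z0 D' E -> sub_near z0 D' D].

(* P = delta^{-1}(Q) for Q with a basis of 1-forms w_i(f(x,u)) df^i *)
Definition backward_shift (Q P : codistribution R (n + m)) : Prop :=
  exists (r : nat) (w : 'I_r -> 'rV[R]_n -> 'cV[R]_n),
    [/\ forall a, smooth_near (f z0) (w a),
        \forall z \near z0,
          basis_of (Q z) [seq pullback_form f (w a) z | a : 'I_r]
      & \forall z \near z0,
          P z = <<[seq pullback_form pi_map (w a) z | a : 'I_r]>>%VS].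

(* span {d_u} *)
Definition span_du : tdistribution R (n + m) :=
  fun=> <<[seq delta_mx 0%R (rshift n j) | j : 'I_m]>>%VS.

Definition step_A (E E' : tdistribution R (n + m)) : Prop :=
  exists (D : tdistribution R (n + m)) (Delta : tdistribution R n),
    [/\ largest_projectable E D, pushforward_dist D Delta,
        regular_near (f z0) Delta,
        \forall z \near z0, E' z = preimage_dist pi_map Delta z
      & regular_near z0 E'].

(* A run of Algorithm A that stops in step kbar, i.e. kbar is the first step
   in which the stopping criterion is met. *)
Definition algorithm_A (kbar : nat) (E : nat -> tdistribution R (n + m)) :
    Prop :=
  [/\ (1 <= kbar)%N,
      \forall z \near z0, E 0%N z = span_du z,
      forall k, (1 <= k <= kbar)%N -> step_A (E k.-1) (E k)
    & forall k, (1 <= k <= kbar)%N ->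
        ((\forall z \near z0, \dim (E k z) = \dim (E k.-1 z)) <-> k = kbar)].

Definition step_B (P P' : codistribution R (n + m)) : Prop :=
  exists Pplus : codistribution R (n + m),
    [/\ regular_near z0 (fun z => P z :&: dspan f z)%VS,
        smallest_invariant z0 (fun z => coann (dspan f z))
          (fun z => P z :&: dspan f z)%VS Pplus,
        backward_shift Pplus P'
      & regular_near z0 P'].

(* As for Algorithm A; the sequence is indexed from 1, P 0 is irrelevant. *)
Definition algorithm_B (kbar : nat) (P : nat -> codistribution R (n + m)) :
    Prop :=
  [/\ (1 <= kbar)%N,
      \forall z \near z0, P 1%N z = dspan pi_map z,
      forall k, (1 <= k <= kbar)%N -> step_B (P k) (P k.+1)
    & forall k, (1 <= k <= kbar)%N ->
        ((\forall z \near z0, P k.+1 z = P k z) <-> k = kbar)].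

End System.

(* Main.v *)
(* Idea.  Let J be the Jacobian of f and suppose P_k = ann (E_{k-1}), where
   E_{k-1} is the row space of a matrix X of smooth vector fields.  Let A(y) be
   the matrix whose rows span Delta_k = f_* D_{k-1}, and let the columns of W(y)
   be the 1-forms w_a with P_{k+1}^+ = span { J W(f) }.  It suffices to show
   that ker A(y) is the column space of W(y), since pi then transports the
   equality to P_{k+1} = ann (E_k).
   - The codistribution f^* (ann Delta_k) = { J c | A(f) c = 0 } is invariant
     along ker f_*: a 1-form J c satisfies L_v (J c) = J (D_v c) when v J = 0,
     because second derivatives commute.  It contains P_k /\ span {df} as
     D_{k-1} is a subdistribution of E_{k-1}, so by minimality it contains
     P_{k+1}^+, that is, A W = 0.
   - Conversely, let the rows of B(y) be a smooth basis of the vectors killed by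
     W(y).  As P_k /\ span {df} is contained in P_{k+1}^+, they lie in the row
     space of X J, which has constant rank, so B(f) = L J for a smooth L with
     rows in E_{k-1}.  The rows of L span a projectable subdistribution of
     E_{k-1}, hence lie in D_{k-1}; pushing forward, the rows of B lie in
     Delta_k, so that ker A is contained in the column space of W.
   The adapted coordinates needed for projectability come from the inverse
   function theorem. *)
Require Import Defs.
From HB Require Import structures.
From mathcomp Require Import all_boot all_order all_algebra.
From mathcomp Require Import all_classical all_reals all_analysis.
From mathcomp Require Import ring lra.

Set Implicit Arguments.
Unset Strict Implicit.
Unset Printing Implicit Defensive.

Import Order.TTheory GRing.Theory Num.Theory.
Import numFieldNormedType.Exports.

Local Open Scope classical_set_scope.
Local Open Scope ring_scope.

(** * Smoothness of finite order on an open set *)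

Section Ck.
Variable R : realType.

(** The first-order expansion of [f] at [x] also serves for [g], as the two maps agree near [x] and
    at [x] itself; uniqueness of the differential then identifies its linear part with ['d g x]. *)
Lemma near_eq_differentiable (V W : normedModType R) (f g : V -> W) (x : V) :
  (\forall z \near x, f z = g z) -> differentiable f x -> differentiable g x.
Proof.
move=> fg df.
have cdf : continuous ('d f x) by exact: diff_continuous.
have E : g \o shift x = cst (g x) + 'd f x +o_ (0 : V) id.
  apply/eqaddoP => e e0.
  have /eqaddoP/(_ e e0) := diff_locally df.
  have fg' : \forall z \near (0 : V), f (z + x) = g (z + x).
    by move: fg; rewrite (near_shift 0) subr0.
  apply: filterS2 fg' => z fgz; rewrite !fctE/= fgz.
  by rewrite (nbhs_singleton fg).
apply/diff_locallyP; rewrite (diff_unique cdf E); split=> //.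
Qed.

(* smooth_near asks for one neighborhood valid for all orders of derivation;
   fixing the open set U allows closure properties to be proved by induction on
   the order k. *)
Fixpoint Ck (V W : normedModType R) (k : nat) (U : set V) (g : V -> W) : Prop :=
  (forall z, U z -> differentiable g z) /\
  if k is k'.+1 then forall v, Ck k' U ('D_v g) else True.

Lemma Ck_diff (V W : normedModType R) k U (g : V -> W) z :
  Ck k U g -> U z -> differentiable g z.
Proof. by case: k => [|k] [dg _]; apply: dg. Qed.

Lemma Ck_pred (V W : normedModType R) k U (g : V -> W) :
  Ck k.+1 U g -> Ck k U g.
Proof.
elim: k g => [|k IH] g [dg Dg]; split=> // v.
exact/IH/Dg.
Qed.

Lemma Ck_ext (V W : normedModType R) k U (f g : V -> W) : open U ->
  (forall z, U z -> f z = g z) -> Ck k U f -> Ck k U g.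
Proof.
move=> Uo; have nearU P z : (forall x, U x -> P x) -> U z -> \forall x \near z, P x.
  by move=> UP Uz; have := open_nbhs_nbhs (conj Uo Uz); apply: filterS.
elim: k f g => [|k IH] f g fg.
  case=> df _; split=> // z Uz.
  by apply: near_eq_differentiable (df z Uz); exact: nearU.
move=> [df Df]; split=> [z Uz|v].
  by apply: near_eq_differentiable (df z Uz); exact: nearU.
apply: IH (Df v) => z Uz; apply: near_eq_derive; exact: nearU.
Qed.

Lemma Ck_sub (V W : normedModType R) k (U U' : set V) (g : V -> W) : U' `<=` U ->
  Ck k U g -> Ck k U' g.
Proof.
move=> UU; elim: k g => [|k IH] g [dg Dg]; split=> //; try by move=> z /UU /dg.
move=> v; exact: IH (Dg v).
Qed.

Lemma Ck_iter_derive (V W : normedModType R) (U : set V) (g : V -> W) :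
  (forall z, U z -> forall s, differentiable (iter_derive s g) z) ->
  forall k, Ck k U g.
Proof.
move=> sg k; elim: k g sg => [|k IH] g sg; split=> //;
  try by move=> z /sg /(_ [::]).
move=> v; apply: IH => z Uz s.
(* In [iter_derive] the last vector of the list is the first direction of derivation, so replacing
   [g] by ['D_v g] appends [v] at the end. *)
by have := sg z Uz (rcons s v); rewrite /iter_derive foldr_rcons.
Qed.

Lemma smooth_near_CkP (V W : normedModType R) (z0 : V) (g : V -> W) :
  smooth_near z0 g <->
  exists2 U : set V, open U /\ U z0 & forall k, Ck k U g.
Proof.
split=> [sg|[U [Uo Uz] gU]].
  exists (interior [set z | forall s, differentiable (iter_derive s g) z]).
    by split; [exact: open_interior|exact: sg].
  by apply: Ck_iter_derive => z /interior_subset.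
rewrite /smooth_near; near=> z => s.
have {}gU : Ck (size s) U g by exact: gU.
have Uz' : U z by near: z; exact: open_nbhs_nbhs.
elim/last_ind: s g gU => [|s v IH] g; first by case=> dg _; exact: dg.
rewrite size_rcons => -[_ /(_ v)] /IH.
by rewrite /iter_derive foldr_rcons.
Unshelve. all: by end_near. Qed.

Section closure.
Variable V : normedModType R.
Implicit Types (U : set V) (k : nat).

Lemma Ck_cst (W : normedModType R) k U (c : W) : Ck k U (fun _ : V => c).
Proof.
elim: k c => [|k IH] c; split=> // [v].
rewrite (_ : 'D_v _ = fun=> 0); first exact: IH.
by apply/funext => z; rewrite derive_cst.
Qed.

Lemma Ck_add (W : normedModType R) k U (f g : V -> W) : open U ->
  Ck k U f -> Ck k U g -> Ck k U (fun z => f z + g z).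
Proof.
move=> Uo; elim: k f g => [|k IH] f g [df Df] [dg Dg].
  by split=> // z Uz; apply: differentiableD; [exact: df|exact: dg].
split=> [z Uz|v]; first by apply: differentiableD; [exact: df|exact: dg].
apply: Ck_ext (IH _ _ (Df v) (Dg v)) => // z Uz.
by rewrite -deriveD//; apply: diff_derivable; [exact: df|exact: dg].
Qed.

Lemma Ck_mul k U (f g : V -> R) : open U ->
  Ck k U f -> Ck k U g -> Ck k U (fun z => f z * g z).
Proof.
move=> Uo; elim: k f g => [|k IH] f g Hf Hg; have [df Df] := Hf; have [dg Dg] := Hg.
  by split=> // z Uz; apply: differentiableM; [exact: df|exact: dg].
split=> [z Uz|v]; first by apply: differentiableM; [exact: df|exact: dg].
have := Ck_add Uo (IH _ _ (Ck_pred Hf) (Dg v)) (IH _ _ (Ck_pred Hg) (Df v)).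
apply: Ck_ext => // z Uz.
by rewrite [RHS]deriveM//; apply: diff_derivable; [exact: df|exact: dg].
Qed.

Lemma Ck_sum (W : normedModType R) (I : Type) (r : seq I) (P : pred I) k U
    (f : I -> V -> W) : open U ->
  (forall i, Ck k U (f i)) -> Ck k U (fun z => \sum_(i <- r | P i) f i z).
Proof.
move=> Uo Hf; elim: r => [|i r IH].
  by apply: Ck_ext (Ck_cst k U 0) => // z _; rewrite big_nil.
case Pi : (P i); last by apply: Ck_ext IH => // z _; rewrite big_cons Pi.
by apply: Ck_ext (Ck_add Uo (Hf i) IH) => // z _; rewrite big_cons Pi.
Qed.

Lemma Ck_prod (I : Type) (r : seq I) (P : pred I) k U
    (f : I -> V -> R) : open U ->
  (forall i, Ck k U (f i)) -> Ck k U (fun z => \prod_(i <- r | P i) f i z).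
Proof.
move=> Uo Hf; elim: r => [|i r IH].
  by apply: Ck_ext (Ck_cst k U (1 : R)) => // z _; rewrite big_nil.
case Pi : (P i); last by apply: Ck_ext IH => // z _; rewrite big_cons Pi.
by apply: Ck_ext (Ck_mul Uo (Hf i) IH) => // z _; rewrite big_cons Pi.
Qed.

(** By induction on the order: the derivative [- f^-2 * 'D_v f] involves [f^-1] only at the previous
    order. *)
Lemma Ck_inv k U (f : V -> R) : open U -> (forall z, U z -> f z != 0) ->
  Ck k U f -> Ck k U (fun z => (f z)^-1).
Proof.
move=> Uo f0; have d1 : (forall z, U z -> differentiable f z) ->
    forall z, U z -> differentiable (fun z => (f z)^-1) z.
  by move=> df z Uz; apply: differentiableV; [exact: df|exact: f0].
elim: k => [|k IH] Hf; have [df Df] := Hf; split=> //; try exact: d1.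
move=> v; have Hi := IH (Ck_pred Hf).
have := Ck_mul Uo (Ck_mul Uo (Ck_cst k U (-1 : R)) (Ck_mul Uo Hi Hi)) (Df v).
apply: Ck_ext => // z Uz.
rewrite [RHS]deriveV ?f0//; last by apply: diff_derivable; exact: df.
by rewrite -exprVn expr2 mulN1r.
Qed.

End closure.

Lemma Ck_id (V : normedModType R) k (U : set V) : Ck k U (fun z : V => z).
Proof.
case: k => [|k]; split=> // v.
rewrite (_ : 'D_v _ = fun=> v); first exact: Ck_cst.
by apply/funext => z; rewrite derive_id.
Qed.

Lemma differentiable_mxP (V : normedModType R) (p q : nat) (g : V -> 'M[R]_(p, q)) z :
  differentiable g z <-> forall i j, differentiable (fun x => g x i j) z.
Proof.
split=> [dg i j|dg].
  exact: (@differentiable_comp _ _ _ _ g (fun N : 'M[R]_(p, q) => N i j) z dg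
    (differentiable_coord _ _ _)).
rewrite (_ : g = \sum_i \sum_j (fun x => g x i j *: delta_mx i j)); last first.
  apply/funext => x; rewrite fct_sumE [LHS]matrix_sum_delta; apply: eq_bigr => i _.
  by rewrite fct_sumE.
apply: differentiable_sum => i; apply: differentiable_sum => j.
exact: differentiableZl.
Qed.

Lemma derive_mxE (V : normedModType R) (p q : nat) (g : V -> 'M[R]_(p, q)) z v i j :
  differentiable g z -> 'D_v g z i j = 'D_v (fun x => g x i j) z.
Proof. by move=> dg; rewrite derive_mx ?mxE//; exact: diff_derivable. Qed.

Lemma Ck_mxP (V : normedModType R) (p q k : nat) (U : set V) (g : V -> 'M[R]_(p, q)) :
  open U -> Ck k U g <-> forall i j, Ck k U (fun x => g x i j).
Proof.
move=> Uo; elim: k g => [|k IH] g; split.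
- by move=> [dg _] i j; split=> // z Uz; exact: ((differentiable_mxP g z).1 (dg z Uz) i j).
- by move=> dg; split=> // z Uz; apply/differentiable_mxP => i j; apply: Ck_diff (dg i j) _.
- move=> [dg Dg] i j; split=> [z Uz|v]; first exact: ((differentiable_mxP g z).1 (dg z Uz) i j).
  apply: Ck_ext ((IH _).1 (Dg v) i j) => // z Uz; apply: derive_mxE; exact: dg.
- move=> dg.
  have dg' z : U z -> differentiable g z.
    by move=> Uz; apply/differentiable_mxP => i j; apply: Ck_diff (dg i j) _.
  split=> // v; apply/IH => i j.
  have [_ /(_ v)] := dg i j; apply: Ck_ext => // z Uz.
  by rewrite derive_mxE//; exact: dg'.
Qed.

Lemma diff_rV_sum (p : nat) (W : normedModType R) (g : 'rV[R]_p -> W) y w :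
  differentiable g y -> 'd g y w = \sum_i w 0 i *: 'D_(delta_mx 0 i) g y.
Proof.
move=> dg; rewrite [in LHS](row_sum_delta w) linear_sum; apply: eq_bigr => i _.
by rewrite linearZ/= deriveE.
Qed.

(** Chain rule and induction: ['D_v (g \o phi)] is a finite sum of products of a coordinate of
    ['D_v phi] with a partial derivative of [g] composed with [phi], and both factors have one order
    less. *)
Lemma Ck_comp_scalar (V : normedModType R) (p k : nat) (U : set V) (U' : set 'rV[R]_p)
    (g : 'rV[R]_p -> R) (phi : V -> 'rV[R]_p) : open U ->
  (forall z, U z -> U' (phi z)) -> Ck k U' g -> Ck k U phi ->
  Ck k U (fun z => g (phi z)).
Proof.
move=> Uo UU; elim: k g => [|k IH] g Hg Hphi; have [dg Dg] := Hg; have [dphi Dphi] := Hphi.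
  split=> // z Uz; apply: (@differentiable_comp _ _ _ _ phi g); first exact: dphi.
  exact/dg/UU.
split=> [z Uz|v].
  by apply: (@differentiable_comp _ _ _ _ phi g); [exact: dphi|exact/dg/UU].
have : Ck k U (fun z => \sum_i ('D_v phi z) 0 i * 'D_(delta_mx 0 i) g (phi z)).
  apply: Ck_sum => // i; apply: Ck_mul => //.
    by have /(Ck_mxP k _ Uo) := Dphi v; exact.
  exact: IH (Dg _) (Ck_pred Hphi).
apply: Ck_ext => // z Uz.
have dgz : differentiable g (phi z) by exact/dg/UU.
have dphiz : differentiable phi z by exact: dphi.
rewrite [RHS]deriveE; last exact: (@differentiable_comp _ _ _ _ phi g).
by rewrite (@diff_comp _ _ _ _ phi g)//= diff_rV_sum// -deriveE.
Qed.

Lemma Ck_comp (V : normedModType R) (p q r k : nat) (U : set V) (U' : set 'rV[R]_p)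
    (g : 'rV[R]_p -> 'M[R]_(q, r)) (phi : V -> 'rV[R]_p) : open U -> open U' ->
  (forall z, U z -> U' (phi z)) -> Ck k U' g -> Ck k U phi ->
  Ck k U (fun z => g (phi z)).
Proof.
move=> Uo Uo' UU /(Ck_mxP _ _ Uo') Hg Hphi; apply/(Ck_mxP _ _ Uo) => i j.
exact: (Ck_comp_scalar Uo UU (Hg i j) Hphi).
Qed.

Lemma Ck_mulmx (V : normedModType R) (p q r k : nat) (U : set V)
    (A : V -> 'M[R]_(p, q)) (B : V -> 'M[R]_(q, r)) : open U ->
  Ck k U A -> Ck k U B -> Ck k U (fun z => A z *m B z).
Proof.
move=> Uo /(Ck_mxP _ _ Uo) HA /(Ck_mxP _ _ Uo) HB; apply/(Ck_mxP _ _ Uo) => i j.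
have : Ck k U (fun z => \sum_l A z i l * B z l j).
  by apply: Ck_sum => // l; apply: Ck_mul.
by apply: Ck_ext => // z _; rewrite mxE.
Qed.

Lemma Ck_det (V : normedModType R) (p k : nat) (U : set V) (A : V -> 'M[R]_p) :
  open U -> Ck k U A -> Ck k U (fun z => \det (A z)).
Proof.
move=> Uo /(Ck_mxP _ _ Uo) HA; apply: Ck_sum => // s; apply: Ck_mul => //.
  exact: Ck_cst.
by apply: Ck_prod => // i.
Qed.

Lemma Ck_invmx (V : normedModType R) (p k : nat) (U : set V) (A : V -> 'M[R]_p) :
  open U -> (forall z, U z -> A z \in unitmx) ->
  Ck k U A -> Ck k U (fun z => invmx (A z)).
Proof.
move=> Uo Au HA; apply/(Ck_mxP _ _ Uo) => i j.
(* An entry of the inverse is a cofactor divided by the determinant; the adjugate transposes, hence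
   row [j] and column [i] are removed. *)
have : Ck k U (fun z => (\det (A z))^-1 * ((-1) ^+ (j + i) * \det (row' j (col' i (A z))))).
  apply: Ck_mul => //; first apply: Ck_inv => //.
  - by move=> z /Au; rewrite unitmxE unitfE.
  - exact: Ck_det.
  - apply: Ck_mul => //; first exact: Ck_cst.
    apply: Ck_det => //; apply/(Ck_mxP _ _ Uo) => a b.
    have /(_ (lift j a) (lift i b)) := (Ck_mxP k A Uo).1 HA.
    by apply: Ck_ext => // z _; rewrite !mxE.
by apply: Ck_ext => // z Uz; rewrite /invmx Au// !mxE.
Qed.

End Ck.

(** * Germs of smooth functions and matrices of constant rank *)

Section smooth_near_theory.
Variable R : realType.

Lemma smooth_near_diff (V W : normedModType R) (z0 : V) (g : V -> W) :
  smooth_near z0 g -> \forall z \near z0, differentiable g z.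
Proof. by apply: filterS => z /(_ [::]). Qed.

Lemma smooth_near_diff0 (V W : normedModType R) (z0 : V) (g : V -> W) :
  smooth_near z0 g -> differentiable g z0.
Proof. by move/smooth_near_diff/nbhs_singleton. Qed.

Lemma smooth_near_near (V W : normedModType R) (z0 : V) (g : V -> W) :
  smooth_near z0 g -> \forall z \near z0, smooth_near z g.
Proof. by move=> sg; apply: nbhs_interior. Qed.

Lemma smooth_near_cvg (V W : normedModType R) (z0 : V) (g : V -> W) :
  smooth_near z0 g -> g z @[z --> z0] --> g z0.
Proof. by move/smooth_near_diff0/differentiable_continuous. Qed.

Lemma smooth_near_ext (V W : normedModType R) (z0 : V) (f g : V -> W) :
  (\forall z \near z0, f z = g z) -> smooth_near z0 f -> smooth_near z0 g.
Proof.
move=> fg /smooth_near_CkP[U [Uo Uz] Hf]; apply/smooth_near_CkP.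
exists (U `&` interior [set z | f z = g z]).
  by split; [apply: openI => //; exact: open_interior|].
move=> k; apply: Ck_ext (Ck_sub (@subIsetl _ _ _) (Hf k)).
  by apply: openI => //; exact: open_interior.
by move=> z [_ /interior_subset].
Qed.

Lemma smooth_near_cst (V W : normedModType R) (z0 : V) (c : W) :
  smooth_near z0 (fun _ : V => c).
Proof. by apply/smooth_near_CkP; exists setT; [split=> //; exact: openT|move=> k; exact: Ck_cst]. Qed.

Lemma smooth_near_id (V : normedModType R) (z0 : V) : smooth_near z0 (fun z : V => z).
Proof. by apply/smooth_near_CkP; exists setT; [split=> //; exact: openT|move=> k; exact: Ck_id]. Qed.

Lemma smooth_near_derive (V W : normedModType R) (z0 : V) (g : V -> W) v :
  smooth_near z0 g -> smooth_near z0 ('D_v g).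
Proof.
move=> /smooth_near_CkP[U [Uo Uz] Hg]; apply/smooth_near_CkP; exists U => // k.
exact: (Hg k.+1).2.
Qed.

Lemma smooth_near2 (V W1 W2 W : normedModType R) (z0 : V) (f : V -> W1) (g : V -> W2)
    (h : V -> W) :
  (forall k (U : set V), open U -> Ck k U f -> Ck k U g -> Ck k U h) ->
  smooth_near z0 f -> smooth_near z0 g -> smooth_near z0 h.
Proof.
move=> H /smooth_near_CkP[U [Uo Uz] Hf] /smooth_near_CkP[U' [Uo' Uz'] Hg].
apply/smooth_near_CkP; exists (U `&` U'); first by split=> //; exact: openI.
move=> k; apply: H; first exact: openI.
  exact: Ck_sub (@subIsetl _ _ _) (Hf k).
exact: Ck_sub (@subIsetr _ _ _) (Hg k).
Qed.

Lemma smooth_near_add (V W : normedModType R) (z0 : V) (f g : V -> W) :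
  smooth_near z0 f -> smooth_near z0 g -> smooth_near z0 (fun z => f z + g z).
Proof. by apply: smooth_near2 => k U; exact: Ck_add. Qed.

Lemma smooth_near_mulmx (V : normedModType R) (p q r : nat) (z0 : V)
    (A : V -> 'M[R]_(p, q)) (B : V -> 'M[R]_(q, r)) :
  smooth_near z0 A -> smooth_near z0 B -> smooth_near z0 (fun z => A z *m B z).
Proof. by apply: smooth_near2 => k U; exact: Ck_mulmx. Qed.

Lemma smooth_near_mx1 (V : normedModType R) (p q : nat) (z0 : V)
    (g : V -> 'M[R]_(p, q)) i j :
  smooth_near z0 g -> smooth_near z0 (fun z => g z i j).
Proof.
move=> /smooth_near_CkP[U [Uo Uz] Hg]; apply/smooth_near_CkP; exists U => // k.
exact: (Ck_mxP k g Uo).1.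
Qed.

(** There are finitely many entries, so their neighborhoods, each valid for all orders, have a
    common one. *)
Lemma smooth_near_mx (V : normedModType R) (p q : nat) (z0 : V)
    (g : V -> 'M[R]_(p, q)) :
  (forall i j, smooth_near z0 (fun z => g z i j)) -> smooth_near z0 g.
Proof.
move=> Hg.
pose A := [set z | forall i j s, differentiable (iter_derive s (fun z => g z i j)) z].
have A0 : nbhs z0 A.
  by apply: filter_forall => i; apply: filter_forall => j; exact: Hg.
apply/smooth_near_CkP; exists (interior A).
  by split; [exact: open_interior|].
move=> k; apply/Ck_mxP; first exact: open_interior.
by move=> i j; apply: Ck_iter_derive => z /interior_subset /(_ i j).
Qed.

Lemma smooth_near_comp (V : normedModType R) (p q r : nat) (z0 : V)
    (g : 'rV[R]_p -> 'M[R]_(q, r)) (phi : V -> 'rV[R]_p) :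
  smooth_near z0 phi -> smooth_near (phi z0) g -> smooth_near z0 (fun z => g (phi z)).
Proof.
move=> sphi; have cphi := smooth_near_cvg sphi.
move: sphi => /smooth_near_CkP[U [Uo Uz] Hphi] /smooth_near_CkP[U' [Uo' Uz'] Hg].
have nU' : \forall z \near z0, U' (phi z) by apply: cphi; exact: open_nbhs_nbhs.
apply/smooth_near_CkP; exists (U `&` interior [set z | U' (phi z)]).
  by split; [apply: openI => //; exact: open_interior|].
move=> k; apply: (Ck_comp _ Uo' _ (Hg k)).
- by apply: openI => //; exact: open_interior.
- by move=> z [_ /interior_subset].
- exact: Ck_sub (@subIsetl _ _ _) (Hphi k).
Qed.

Lemma det_cvg (V : normedModType R) (p : nat) (z0 : V) (A : V -> 'M[R]_p) :
  smooth_near z0 A -> (\det (A z)) @[z --> z0] --> \det (A z0).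
Proof.
move=> /smooth_near_CkP[U [Uo Uz] HA].
have : smooth_near z0 (fun z => \det (A z)).
  by apply/smooth_near_CkP; exists U => // k; exact: Ck_det.
exact: smooth_near_cvg.
Qed.

Lemma near_unitmx (V : normedModType R) (p : nat) (z0 : V) (A : V -> 'M[R]_p) :
  smooth_near z0 A -> A z0 \in unitmx -> \forall z \near z0, A z \in unitmx.
Proof.
move=> sA; rewrite unitmxE unitfE => A0.
have nb : nbhs (\det (A z0)) [set x : R | x != 0].
  by apply: open_nbhs_nbhs; split=> //; exact: open_neq.
have nd : \forall z \near z0, \det (A z) != 0 by exact: det_cvg nb.
by apply: filterS nd => z; rewrite unitmxE unitfE.
Qed.

Lemma smooth_near_invmx (V : normedModType R) (p : nat) (z0 : V) (A : V -> 'M[R]_p) :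
  smooth_near z0 A -> A z0 \in unitmx -> smooth_near z0 (fun z => invmx (A z)).
Proof.
move=> sA A0; have nA := near_unitmx sA A0.
move: sA => /smooth_near_CkP[U [Uo Uz] HA].
apply/smooth_near_CkP; exists (U `&` interior [set z | A z \in unitmx]).
  by split; [apply: openI => //; exact: open_interior|].
move=> k; apply: Ck_invmx.
- by apply: openI => //; exact: open_interior.
- by move=> z [_ /interior_subset].
- exact: Ck_sub (@subIsetl _ _ _) (HA k).
Qed.

Lemma smooth_near_jacobian (p q : nat) (z0 : 'rV[R]_p) (g : 'rV[R]_p -> 'rV[R]_q) :
  smooth_near z0 g -> smooth_near z0 (fun z => 'J g z).
Proof.
move=> sg; apply: smooth_near_mx => i j.
have := smooth_near_mx1 0 j (smooth_near_derive (delta_mx 0 i) sg).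
apply: smooth_near_ext; apply: filterS (smooth_near_diff sg) => z dg.
by rewrite deriveE// /jacobian mxE.
Qed.

(** Constant one-sided inverses [S] and [T] of the two factors of a rank factorization of [M z0]
    replace the choice of a nonzero minor: [S *m M z *m T] is the identity at [z0], hence invertible
    nearby. *)
Lemma const_rank_minor (V : normedModType R) (p q : nat) (z0 : V)
    (M : V -> 'M[R]_(p, q)) : smooth_near z0 M ->
  exists (S : 'M[R]_(\rank (M z0), p)) (T : 'M[R]_(q, \rank (M z0))),
    smooth_near z0 (fun z => S *m M z *m T) /\ S *m M z0 *m T \in unitmx.
Proof.
move=> sM; set r := \rank (M z0).
have [S SC] : exists S : 'M[R]_(r, p), S *m col_base (M z0) = 1%:M.
  by exists (pinvmx (col_base (M z0))); rewrite mulVpmx// col_base_full.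
have [T CT] : exists T : 'M[R]_(q, r), row_base (M z0) *m T = 1%:M.
  by exists (pinvmx (row_base (M z0))); rewrite mulmxVp// row_base_free.
exists S, T; split.
  apply: smooth_near_mulmx; last exact: smooth_near_cst.
  by apply: smooth_near_mulmx => //; exact: smooth_near_cst.
by rewrite -{1}(mulmx_base (M z0)) mulmxA SC mul1mx CT unitmx1.
Qed.

(* If S M T is an invertible r x r matrix and r is the rank of M, then M and
   M T have the same column space, whence T (S M T)^-1 S is a quasi-inverse. *)
Lemma const_rank_qinv (V : normedModType R) (p q : nat) (z0 : V)
    (M : V -> 'M[R]_(p, q)) : smooth_near z0 M ->
  (\forall z \near z0, \rank (M z) = \rank (M z0)) ->
  exists G : V -> 'M[R]_(q, p), smooth_near z0 G /\
    \forall z \near z0, M z *m G z *m M z = M z.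
Proof.
move=> sM rM; have [S [T [sA uA]]] := const_rank_minor sM.
exists (fun z => T *m invmx (S *m M z *m T) *m S); split.
  apply: smooth_near_mulmx; last exact: smooth_near_cst.
  apply: smooth_near_mulmx; first exact: smooth_near_cst.
  exact: smooth_near_invmx sA uA.
apply: filterS2 (near_unitmx sA uA) rM => z uAz rMz.
have rMT : \rank (M z *m T) = \rank (M z0).
  apply/eqP; rewrite eqn_leq (leq_trans (mxrankM_maxl _ _)) ?rMz//=.
  by rewrite -[leqLHS](mxrank_unit uAz) -mulmxA mxrankM_maxr.
have : ((M z)^T <= (M z *m T)^T)%MS.
  rewrite -(geq_leqif (mxrank_leqif_sup _)); last by rewrite trmx_mul submxMl.
  by rewrite !mxrank_tr rMT rMz.
move=> /submxP[Y /(congr1 trmx)]; rewrite trmx_mul !trmxK => E.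
have -> : M z *m (T *m invmx (S *m M z *m T) *m S) *m M z =
    M z *m T *m invmx (S *m M z *m T) *m (S *m M z *m T) *m Y^T.
  by rewrite [X in _ *m X = _]E !mulmxA.
by rewrite mulmxKV.
Qed.

(** As [S *m M z *m T] stays invertible, [S *m M z] has rank at least that of [M z0], so its row
    space fills that of [M z]. The selection [S] does not depend on [z]. *)
Lemma const_rank_basis (V : normedModType R) (p q : nat) (z0 : V)
    (M : V -> 'M[R]_(p, q)) : smooth_near z0 M ->
  (\forall z \near z0, \rank (M z) = \rank (M z0)) ->
  exists S : 'M[R]_(\rank (M z0), p),
    \forall z \near z0, (S *m M z :=: M z)%MS.
Proof.
move=> sM rM; have [S [T [sA uA]]] := const_rank_minor sM.
exists S; apply: filterS2 (near_unitmx sA uA) rM => z uAz rMz.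
apply/eqmxP; rewrite -(geq_leqif (mxrank_leqif_eq _)) ?submxMl//.
by rewrite rMz -[leqLHS](mxrank_unit uAz) mxrankM_maxl.
Qed.

End smooth_near_theory.

(** * Mean value inequality and symmetry of second derivatives *)

Section calculus.
Variable R : realType.

Lemma mx_norm_leP (p q : nat) (M : 'M[R]_(p, q)) (c : R) : 0 <= c ->
  (`|M| <= c <-> forall i j, `|M i j| <= c).
Proof.
move=> c0; rewrite [`|M|]/Num.Def.normr/= mx_normrE.
split=> [/bigmax_leP[_ H] i j|H]; first exact: (H (i, j)).
by apply/bigmax_leP; split.
Qed.

Lemma mx_norm_coef (p q : nat) (M : 'M[R]_(p, q)) i j : `|M i j| <= `|M|.
Proof. exact: (mx_norm_leP M (normr_ge0 M)).1. Qed.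

Lemma mx_norm_mulmx (p q r : nat) (A : 'M[R]_(p, q)) (B : 'M[R]_(q, r)) :
  `|A *m B| <= `|A| * (q%:R * `|B|).
Proof.
apply/mx_norm_leP; first by rewrite !mulr_ge0.
move=> i j; rewrite mxE (le_trans (ler_norm_sum _ _ _))//.
have -> : `|A| * (q%:R * `|B|) = \sum_(k < q) `|A| * `|B|.
  by rewrite sumr_const card_ord mulrCA mulr_natl.
rewrite ler_sum// => k _.
by rewrite normrM ler_pM// mx_norm_coef.
Qed.

Lemma is_derive_line (V W : normedModType R) (g : V -> W) a v (t : R) :
  derivable g (a + t *: v) v ->
  is_derive t (1 : R) (fun s => g (a + s *: v)) ('D_v g (a + t *: v)).
Proof.
move=> dg.
have E : (fun h : R => h^-1 *: (g (a + (h *: (1 : R) + t) *: v) - g (a + t *: v))) =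
    (fun h : R => h^-1 *: (g (h *: v + (a + t *: v)) - g (a + t *: v))).
  by apply/funext => h; rewrite scalerDl addrCA [h *: 1]mulr1.
by split; rewrite /derivable /derive E.
Qed.

Lemma derive_dirZ (V W : normedModType R) (g : V -> W) x (h : R) v :
  differentiable g x -> 'D_(h *: v) g x = h *: 'D_v g x.
Proof. by move=> dg; rewrite !deriveE// linearZ. Qed.

Lemma derive_translate (V W : normedModType R) (g : V -> W) x c v :
  'D_v (fun y => g (y + c)) x = 'D_v g (x + c).
Proof.
rewrite /derive.
have -> // : (fun h : R => h^-1 *: (g (h *: v + x + c) - g (x + c))) =
    (fun h : R => h^-1 *: (g (h *: v + (x + c)) - g (x + c))).
by apply/funext => h; rewrite addrA.
Qed.

Lemma MVT_line (V : normedModType R) (g : V -> R) a v :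
  (forall t : R, 0 <= t <= 1 -> differentiable g (a + t *: v)) ->
  exists2 t : R, 0 <= t <= 1 & g (a + v) - g a = 'D_v g (a + t *: v).
Proof.
move=> dg.
have dl (t : R) : 0 <= t <= 1 ->
    is_derive t (1 : R) (fun s => g (a + s *: v)) ('D_v g (a + t *: v)).
  by move=> t01; apply/is_derive_line/diff_derivable/dg.
have [t|t|t /=] := @MVT R (fun s => g (a + s *: v)) (fun t => 'D_v g (a + t *: v)) 0 1 ltr01.
- by rewrite in_itv/= => /andP[t0 t1]; apply: dl; rewrite !ltW.
- apply: derivable_within_continuous => s; rewrite in_itv/= => s01.
  by have [] := dl s s01.
- rewrite in_itv/= => /andP[t0 t1]; rewrite scale1r scale0r addr0 subr0 mulr1.
  by exists t => //; rewrite !ltW.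
Qed.

(** The matrix norm is the maximum over the entries, so the scalar mean value theorem may be applied
    to each entry separately, with an intermediate point depending on the entry. *)
Lemma lipschitz_segment (V : normedModType R) (p q : nat) (g : V -> 'M[R]_(p, q)) a b (c : R) :
  0 <= c ->
  (forall t : R, 0 <= t <= 1 -> differentiable g (a + t *: (b - a)) /\
     `|'D_(b - a) g (a + t *: (b - a))| <= c) ->
  `|g b - g a| <= c.
Proof.
move=> c0 dg; apply/mx_norm_leP => // i j; rewrite !mxE.
have [|t t01] := @MVT_line V (fun x => g x i j) a (b - a).
  by move=> t /dg[/(differentiable_mxP g)].
rewrite subrKC => ->.
have [dgt le_c] := dg t t01.
by rewrite -derive_mxE// (le_trans (mx_norm_coef _ _ _)).
Qed.

Lemma differentiable_linear_approx (V W : normedModType R) (g : V -> W) (L : {linear V -> W}) x :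
  continuous L ->
  (forall e : R, 0 < e -> \forall y \near x, `|g y - g x - L (y - x)| <= e * `|y - x|) ->
  differentiable g x /\ forall v, 'D_v g x = L v.
Proof.
move=> cL H.
have E : g \o shift x = cst (g x) + L +o_ (0 : V) id.
  apply/eqaddoP => e e0; have := H e e0; rewrite (near_shift 0) subr0.
  by apply: filterS => h; rewrite !fctE/= addrK opprD addrA.
have D : 'd g x = L :> (V -> W) by exact: diff_unique cL E.
have dg : differentiable g x by apply/diff_locallyP; rewrite D.
by split=> // v; rewrite deriveE// D.
Qed.

Lemma differentiable_remainder (V W : normedModType R) (g : V -> W) x (e : R) :
  differentiable g x -> 0 < e ->
  \forall y \near x, `|g y - g x - 'd g x (y - x)| <= e * `|y - x|.
Proof.
move=> /diff_locally/eqaddoP H e0; have := H e e0.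
rewrite [X in _ -> X](near_shift 0) subr0; apply: filterS => h.
by rewrite !fctE/= addrK opprD addrA.
Qed.

Section schwarz.
Variables (V : normedModType R) (g : V -> R) (z : V).
Hypothesis dg : \forall x \near z, differentiable g x.

(** The second difference is the increment along [h *: v] of [G x = g (x + h *: w) - g x]. The mean
    value theorem turns it into [h] times a difference of two values of ['D_v g], which
    differentiability of ['D_v g] at the single point [z] controls. *)
Lemma second_difference v w : differentiable ('D_v g) z ->
  forall e : R, 0 < e -> \forall h \near 0^'+,
  `|g (z + h *: v + h *: w) - g (z + h *: v) - g (z + h *: w) + g z
     - h ^+ 2 * 'D_w ('D_v g) z| <= h ^+ 2 * e.
Proof.
move=> ddg e e0.
(* The two points where ['D_v g] is expanded lie at distances from [z] adding up to at most
   [h * (2 * |v| + |w|)]; the added 1 keeps [c] positive. *)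
pose c := `|v| *+ 2 + `|w| + 1.
have c0 : 0 < c by rewrite ltr_wpDl// addr_ge0// mulrn_wge0.
have dle := differentiable_remainder ddg (divr_gt0 e0 c0).
have [r r0 Hr] := (nbhs_ballP _ _).1 (filterI dg dle).
near=> h.
have h0 : 0 < h by near: h; exact: nbhs_right_gt.
have hr : h * (`|v| + `|w|) < r.
  have c0' : 0 < `|v| + `|w| + 1 by rewrite ltr_wpDl// addr_ge0.
  apply: (@lt_trans _ _ (h * (`|v| + `|w| + 1))); first by rewrite ltr_pM2l// ltrDl.
  by rewrite -ltr_pdivlMr//; near: h; apply: nbhs_right_lt; rewrite divr_gt0.
have inb (s t : R) : 0 <= s <= 1 -> 0 <= t <= 1 ->
    ball z r (z + s *: (h *: v) + t *: (h *: w)).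
  move=> /andP[s0 s1] /andP[t0 t1].
  rewrite -ball_normE/= -addrA opprD addrA subrr sub0r normrN (le_lt_trans _ hr)//.
  rewrite (le_trans (ler_normD _ _))// mulrDr !normrZ !ger0_norm ?(ltW h0)//.
  by rewrite lerD// ler_piMl// mulr_ge0// ltW.
pose G x := g (x + h *: w) - g x.
have dsh x : differentiable g (x + h *: w) -> differentiable (fun y => g (y + h *: w)) x.
  by move=> d; apply: (@differentiable_comp _ _ _ _ (fun y => y + h *: w) g).
have inb0 (s : R) : 0 <= s <= 1 -> ball z r (z + s *: (h *: v)).
  by move=> s01; have := inb s 0 s01; rewrite scale0r addr0 lexx ler01; exact.
have inb1 (s : R) : 0 <= s <= 1 -> ball z r (z + s *: (h *: v) + h *: w).
  by move=> s01; have := inb s 1 s01; rewrite scale1r lexx ler01; exact.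
have [|t t01 GE] := @MVT_line V G z (h *: v).
  move=> t t01; apply: differentiableB; last by case: (Hr _ (inb0 t t01)).
  by apply: dsh; case: (Hr _ (inb1 t t01)).
have [d0 le0] := Hr _ (inb0 t t01); have [d1 le1] := Hr _ (inb1 t t01).
have {}GE : G (z + h *: v) - G z =
    h * ('D_v g (z + t *: (h *: v) + h *: w) - 'D_v g (z + t *: (h *: v))).
  rewrite GE /G deriveB; [|exact/diff_derivable/dsh|exact: diff_derivable].
  by rewrite derive_translate !derive_dirZ// -scalerBr.
have -> : g (z + h *: v + h *: w) - g (z + h *: v) - g (z + h *: w) + g z =
    G (z + h *: v) - G z.
  rewrite /G opprB -!addrA; congr (_ + _).
  by rewrite addrCA addrC -!addrA addrC.
rewrite GE expr2 -!mulrA -mulrBr normrM (ger0_norm (ltW h0)) ler_pM2l//.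
(* The linear parts in [t *: (h *: v)] cancel, leaving [h * 'D_w ('D_v g) z] and two remainders. *)
have -> : 'D_v g (z + t *: (h *: v) + h *: w) - 'D_v g (z + t *: (h *: v)) - h * 'D_w ('D_v g) z
  = ('D_v g (z + t *: (h *: v) + h *: w) - 'D_v g z - 'd ('D_v g) z (z + t *: (h *: v) + h *: w - z))
  - ('D_v g (z + t *: (h *: v)) - 'D_v g z - 'd ('D_v g) z (z + t *: (h *: v) - z)).
  rewrite (deriveE w ddg) -(addrA z) ![z + _ - z]addrC !addKr linearD.
  rewrite [in RHS](linearZ _ w)/=.
  set a := 'd _ _ (t *: _); set b := h * _; rewrite /GRing.scale/= -/b; ring.
apply: (le_trans (ler_normB _ _)); apply: (le_trans (lerD le1 le0)).
rewrite -mulrDr -(addrA z) ![z + _ - z]addrC !addKr mulrAC ler_pdivrMr//.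
rewrite (mulrC h) -[leRHS]mulrA ler_pM2l//.
rewrite (le_trans (lerD (ler_normD _ _) (lexx _)))//.
rewrite !normrZ !(ger0_norm (ltW h0)) (ger0_norm (andP t01).1) /c.
have X0 : 0 <= h * `|v| by rewrite mulr_ge0// ltW.
have tX : t * (h * `|v|) <= h * `|v| by rewrite ler_piMl// (andP t01).2.
by rewrite !mulrDr mulr1; move: (h * `|v|) (h * `|w|) (t * _) tX => *; lra.
Unshelve. all: by end_near. Qed.

End schwarz.

(** The second difference is symmetric in [v] and [w], and divided by [h ^+ 2] it is within [e / 2]
    of either mixed derivative. *)
Lemma derive_comm (V : normedModType R) (g : V -> R) z v w :
  (\forall x \near z, differentiable g x) ->
  differentiable ('D_v g) z -> differentiable ('D_w g) z ->
  'D_w ('D_v g) z = 'D_v ('D_w g) z.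
Proof.
move=> dg dv dw; apply/eqP; rewrite -subr_eq0 -normr_le0.
apply/ler_addgt0Pl => e e0; rewrite addr0.
have e20 : 0 < e / 2 by rewrite divr_gt0.
(* S is kept opaque: comparing S h v w with S h w v would make unification
   unfold the derivatives. *)
have [S SE] : exists S : R -> V -> V -> R, forall h a b,
    S h a b = g (z + h *: a + h *: b) - g (z + h *: a) - g (z + h *: b) + g z.
  by exists (fun h a b => g (z + h *: a + h *: b) - g (z + h *: a) - g (z + h *: b) + g z).
have H1 : \forall h \near 0^'+,
    `|S h v w - h ^+ 2 * 'D_w ('D_v g) z| <= h ^+ 2 * (e / 2).
  by apply: filterS (second_difference dg w dv e20) => h; rewrite SE.
have H2 : \forall h \near 0^'+,
    `|S h w v - h ^+ 2 * 'D_v ('D_w g) z| <= h ^+ 2 * (e / 2).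
  by apply: filterS (second_difference dg v dw e20) => h; rewrite SE.
near (0 : R)^'+ => h.
have h0 : 0 < h by near: h; exact: nbhs_right_gt.
have [h1 h2] : `|S h v w - h ^+ 2 * 'D_w ('D_v g) z| <= h ^+ 2 * (e / 2) /\
    `|S h w v - h ^+ 2 * 'D_v ('D_w g) z| <= h ^+ 2 * (e / 2).
  by near: h; apply: filterI H1 H2.
move: h1 h2; move: ('D_w ('D_v g) z) ('D_v ('D_w g) z) => D1 D2 h1 h2.
have SC : S h w v = S h v w.
  by rewrite !SE (addrAC z (h *: w)) [X in X + g z]addrAC.
have h20 : 0 < h ^+ 2 by rewrite exprn_gt0.
rewrite -(ler_pM2l h20) -[X in X * _](ger0_norm (ltW h20)) -normrM mulrBr.
rewrite SC in h2.
rewrite (_ : _ - _ = (S h v w - h ^+ 2 * D2) - (S h v w - h ^+ 2 * D1)); last by ring.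
rewrite (le_trans (ler_normB _ _))// (le_trans (lerD h2 h1))//.
by rewrite -mulrDr -splitr.
Unshelve. all: by end_near. Qed.

Lemma smooth_derive_comm (V : normedModType R) (p q : nat) (z : V)
    (g : V -> 'M[R]_(p, q)) v w :
  smooth_near z g -> 'D_w ('D_v g) z = 'D_v ('D_w g) z.
Proof.
move=> sg; apply/matrixP => i j.
have E u u' : 'D_u' ('D_u g) z i j = 'D_u' ('D_u (fun x => g x i j)) z.
  rewrite derive_mxE; last exact/smooth_near_diff0/smooth_near_derive.
  apply: near_eq_derive; apply: filterS (smooth_near_diff sg) => x dgx.
  exact: derive_mxE.
have sgij := smooth_near_mx1 i j sg.
apply: etrans (E v w) _; apply: etrans _ (esym (E w v)).
have dv := smooth_near_diff0 (smooth_near_derive v sgij).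
have dw := smooth_near_diff0 (smooth_near_derive w sgij).
exact: (derive_comm (smooth_near_diff sgij) dv dw).
Qed.

End calculus.

(** * Product rule for matrix-valued maps *)

Section matrix_calculus.
Variable R : realType.

Lemma differentiable_mulmx (V : normedModType R) (p q r : nat)
    (A : V -> 'M[R]_(p, q)) (B : V -> 'M[R]_(q, r)) z :
  differentiable A z -> differentiable B z ->
  differentiable (fun x => A x *m B x) z.
Proof.
move=> /differentiable_mxP dA /differentiable_mxP dB.
apply/differentiable_mxP => i j.
have -> : (fun x => (A x *m B x) i j) = \sum_l (fun x => A x i l * B x l j).
  by apply/funext => x; rewrite mxE fct_sumE.
by apply: differentiable_sum => l; exact: differentiableM.
Qed.

Lemma derive_mulmx (V : normedModType R) (p q r : nat)
    (A : V -> 'M[R]_(p, q)) (B : V -> 'M[R]_(q, r)) z v :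
  differentiable A z -> differentiable B z ->
  'D_v (fun x => A x *m B x) z = 'D_v A z *m B z + A z *m 'D_v B z.
Proof.
move=> dA dB; have dAB := differentiable_mulmx dA dB.
apply/matrixP => i j; rewrite derive_mxE// !mxE -big_split/=.
have -> : (fun x => (A x *m B x) i j) = \sum_l (fun x => A x i l * B x l j).
  by apply/funext => x; rewrite mxE fct_sumE.
have dA' l := @diff_derivable _ _ _ _ _ v ((differentiable_mxP A z).1 dA i l).
have dB' l := @diff_derivable _ _ _ _ _ v ((differentiable_mxP B z).1 dB l j).
rewrite derive_sum => [|l]; last exact: derivableM.
apply: eq_bigr => l _.
apply: (etrans (deriveM (dA' l) (dB' l))); rewrite addrC.
congr (_ + _); first by rewrite (derive_mxE v l j dB).
by rewrite (derive_mxE v i l dA); exact: mulrC.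
Qed.

Lemma mulmxr_continuous (p q r : nat) (B : 'M[R]_(q, r)) :
  continuous (mulmxr B : 'M[R]_(p, q) -> 'M[R]_(p, r)).
Proof.
move=> x; apply/differentiable_continuous/differentiable_mulmx => //.
Qed.

End matrix_calculus.

(** * Inverse function theorem *)

Section inverse_contraction.
Variables (R : realType) (N : nat).
Implicit Types (z a b : 'rV[R]_N).
Variables (F : 'rV[R]_N -> 'rV[R]_N) (z0 : 'rV[R]_N).
Hypotheses (sF : smooth_near z0 F) (uF : 'J F z0 \in unitmx).

Let B := invmx ('J F z0).
Let H z := z - F z *m B.

(** The differential of [H] at [z] is right multiplication by [1 - 'J F z *m B], which vanishes at
    [z0] and is therefore small nearby; the mean value inequality on segments of a ball, which is
    convex, gives the contraction. *)
Lemma inverse_contraction : exists (U : set 'rV[R]_N) (r : R),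
  [/\ open U, 0 < r, (forall k, Ck k U F),
   (forall z, `|z0 - z| <= r -> U z /\ 'J F z \in unitmx) &
   (forall a b, `|z0 - a| <= r -> `|z0 - b| <= r ->
      `|H b - H a| <= 2^-1 * `|b - a|)].
Proof.
have /smooth_near_CkP[U [Uo Uz0] HU] := sF.
have sJ := smooth_near_jacobian sF.
have [C CE] : exists C, forall z, C z = 1%:M + 'J F z *m (- B).
  by exists (fun z => 1%:M + 'J F z *m (- B)).
have sC : smooth_near z0 C.
  apply: (@smooth_near_ext _ _ _ _ (fun z => 1%:M + 'J F z *m (- B))).
    by apply: filterE => z; rewrite CE.
  apply: smooth_near_add; first exact: smooth_near_cst.
  by apply: smooth_near_mulmx => //; exact: smooth_near_cst.
have C0 : C z0 = 0 by rewrite CE mulmxN /B mulmxV// subrr.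
(* The factor [N] lost in [mx_norm_mulmx] is compensated here; [N.+1] keeps the constant positive
   for [N = 0]. *)
have e0 : 0 < ((N.+1%:R : R) * 2)^-1 by rewrite invr_gt0 mulr_gt0.
have nC : \forall z \near z0, `|C z| < ((N.+1%:R : R) * 2)^-1.
  by have := smooth_near_cvg sC; rewrite C0 => /cvgr0Pnorm_lt /(_ _ e0).
have nU : \forall z \near z0, U z by exact: open_nbhs_nbhs.
(* The ball is closed because the fixed point is later found by compactness. *)
have [r Hr] := (nbhs_closedballP _ _).1 (filterI (filterI nU (near_unitmx sJ uF)) nC).
exists U, r%:num; have r0 : 0 < r%:num by [].
have {}Hr z : `|z0 - z| <= r%:num -> (U z /\ 'J F z \in unitmx) /\
    `|C z| < ((N.+1%:R : R) * 2)^-1.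
  by move=> Kz; apply: Hr; rewrite (closed_ballE _ r0).
split; [exact: Uo|exact: r0|exact: HU|by move=> z /Hr[]|].
move=> a b Ka Kb; apply: lipschitz_segment; first by rewrite mulr_ge0.
move=> t /andP[t0 t1].
have Kt : `|z0 - (a + t *: (b - a))| <= r%:num.
  rewrite (_ : z0 - _ = (1 - t) *: (z0 - a) + t *: (z0 - b)); last first.
    rewrite scalerBl scale1r !scalerBr opprD !addrA opprB.
    by apply/rowP => i; rewrite !mxE; ring.
  rewrite (le_trans (ler_normD _ _))// !normrZ !ger0_norm ?subr_ge0//.
  apply: (@le_trans _ _ ((1 - t) * r%:num + t * r%:num)).
    by apply: lerD; apply: ler_wpM2l => //; rewrite subr_ge0.
  by rewrite -mulrDl subrK mul1r.
have [[Ut _] /ltW Ct] := Hr _ Kt.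
have dF := Ck_diff (HU 0%N) Ut.
have dFB : differentiable (fun z => F z *m B) (a + t *: (b - a)).
  exact: differentiable_mulmx.
split; first by apply: differentiableB.
rewrite deriveB; [|exact: derivable_id|exact: diff_derivable].
rewrite derive_id derive_mulmx// derive_cst mulmx0 addr0 deriveEjacobian//.
rewrite -mulmxA -{1}[b - a]mulmx1 -mulmxBr -mulmxN -CE.
rewrite (le_trans (mx_norm_mulmx _ _))// mulrC ler_wpM2r//.
rewrite (le_trans (ler_wpM2l _ Ct))// invfM mulrA ler_piMl ?invr_ge0//.
by rewrite ler_pdivrMr// mul1r ler_nat.
Qed.

End inverse_contraction.

Section inverse_function.
Variables (R : realType) (N : nat).
Implicit Types (z a b y : 'rV[R]_N).

Lemma bounded_closed_ball z (r : R) : bounded_set (closed_ball_ (fun x : 'rV[R]_N => `|x|) z r).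
Proof.
exists (`|z| + r); split; first exact: num_real.
move=> M M_gt y; rewrite /closed_ball_/= => zy; apply: le_trans (ltW M_gt).
rewrite -[y](subrKC z) (le_trans (ler_normD _ _))// lerD2l distrC//.
Qed.

(* A minimizer of |T z - z| on the compact ball is a fixed point. *)
Lemma contraction_fixpoint (T : 'rV[R]_N -> 'rV[R]_N) z0 (r : R) : 0 < r ->
  (forall z, `|z0 - z| <= r -> `|z0 - T z| <= r) ->
  (forall a b, `|z0 - a| <= r -> `|z0 - b| <= r ->
     `|T b - T a| <= 2^-1 * `|b - a|) ->
  (forall z, `|z0 - z| <= r -> {for z, continuous T}) ->
  exists2 z, `|z0 - z| <= r & T z = z.
Proof.
move=> r0 TK Tc Tcont.
pose K := closed_ball_ (fun x : 'rV[R]_N => `|x|) z0 r.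
have [||| p] := @EVT_min_rV R N (fun z => `|T z - z|) K.
- by exists z0; rewrite /K /closed_ball_/= subrr normr0 ltW.
- apply: (@bounded_closed_compact R N K); first exact: bounded_closed_ball.
  exact: closed_closed_ball_.
- apply: continuous_in_subspaceT => z; rewrite inE => Kz.
  apply: (@continuous_comp _ _ _ (fun z => T z - z) Num.norm); last exact: norm_continuous.
  by apply: (@continuousB _ _ _ T id); [exact: Tcont|exact: cvg_id].
rewrite inE => Kp pmin; exists p => //.
have KTp : `|z0 - T p| <= r by exact: TK.
have := pmin (T p); rewrite inE => /(_ KTp) le1.
have := le_trans le1 (Tc _ _ Kp KTp).
rewrite -subr_ge0 -[X in _ - X]mul1r -mulrBl nmulr_rge0 ?normr_le0 ?subr_eq0; last lra.
by move/eqP.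
Qed.

Section local.
Variables (F : 'rV[R]_N -> 'rV[R]_N) (z0 : 'rV[R]_N).
Variables (B : 'M[R]_N) (U : set 'rV[R]_N) (r : R).
Hypotheses (uB : B \in unitmx) (Uo : open U) (r0 : 0 < r).
Hypothesis HU : forall k, Ck k U F.
Hypothesis HK : forall z, `|z0 - z| <= r -> U z /\ 'J F z \in unitmx.
Hypothesis HC : forall a b, `|z0 - a| <= r -> `|z0 - b| <= r ->
  `|(b - F b *m B) - (a - F a *m B)| <= 2^-1 * `|b - a|.

Let c : R := N%:R * `|B| + 1.

Let c_gt0 : 0 < c.
Proof. by rewrite /c ltr_wpDl// mulr_ge0. Qed.

Let mulB_le y : `|y *m B| <= `|y| * c.
Proof.
rewrite (le_trans (mx_norm_mulmx _ _))// ler_wpM2l// /c lerDl//.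
Qed.

(** Split [b - a] into the increment of [z - F z *m B], at most half of [|b - a|], and
    [(F b - F a) *m B]; the first term is absorbed on the left. This yields both injectivity of [F]
    on the ball and continuity of its inverse. *)
Lemma bilipschitz a b : `|z0 - a| <= r -> `|z0 - b| <= r ->
  `|b - a| <= 2 * c * `|F b - F a|.
Proof.
move=> Ka Kb.
have E : b - a = ((b - F b *m B) - (a - F a *m B)) + (F b - F a) *m B.
  by rewrite mulmxBl; apply/rowP => i; rewrite !mxE; ring.
have : `|b - a| <= 2^-1 * `|b - a| + `|F b - F a| * c.
  by rewrite {1}E (le_trans (ler_normD _ _))// lerD ?HC.
have := normr_ge0 (b - a); move: `|b - a| => t t0.
have := normr_ge0 (F b - F a); move: `|F b - F a| => s s0.
move=> H; rewrite -mulrA (mulrC c); lra.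
Qed.

(** As [B] is invertible, [F z = y] says that [z] is a fixed point of [z - F z *m B + y *m B]. The
    radius [r / (2 * c)] makes this map preserve the ball: the contraction and the shift by
    [(F z0 - y) *m B] contribute at most [r / 2] each. *)
Lemma local_surjective y : `|F z0 - y| <= r / (2 * c) ->
  exists2 z, `|z0 - z| <= r & F z = y.
Proof.
move=> yr.
have Kz0 : `|z0 - z0| <= r by rewrite subrr normr0 ltW.
have [||| z Kz] := @contraction_fixpoint (fun z => z - F z *m B + y *m B) z0 r r0.
- move=> z Kz.
  have -> : z0 - (z - F z *m B + y *m B) =
      (z0 - F z0 *m B - (z - F z *m B)) + (F z0 - y) *m B.
    by rewrite mulmxBl; apply/rowP => i; rewrite !mxE; ring.
  rewrite (le_trans (ler_normD _ _))//.
  rewrite (le_trans (lerD (HC Kz Kz0) (mulB_le _)))//.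
  have -> : r = 2^-1 * r + r / (2 * c) * c.
    by field; rewrite lt0r_neq0.
  by rewrite lerD ?ler_wpM2l ?ler_wpM2r ?invr_ge0 ?(ltW c_gt0).
- by move=> a b Ka Kb; rewrite opprD addrACA subrr addr0; exact: HC.
- move=> z Kz; have [Uz _] := HK Kz.
  have dF := Ck_diff (HU 0%N) Uz.
  apply: differentiable_continuous.
  apply: (@differentiableD _ _ _ (fun z => z - F z *m B) (cst (y *m B)));
    last exact: differentiable_cst.
  apply: (@differentiableB _ _ _ id (fun z => F z *m B)); first exact: ex_diff.
  by apply: differentiable_mulmx; [exact: dF|exact: differentiable_cst].
- rewrite -addrA -[RHS]addr0 => /addrI.
  rewrite -mulNmx -mulmxDl => /(congr1 (mulmx^~ (invmx B))).
  rewrite /= mulmxK// mul0mx => /eqP; rewrite addrC subr_eq0 => /eqP ->.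
  by exists z.
Qed.

(** On [V] a preimage in the ball exists, so the default value [z0] matters only outside [V]. *)
Let Psi y := xget z0 [set z | `|z0 - z| <= r /\ F z = y].
Let V := ball (F z0) (r / (2 * c)).

Let PsiP y : V y -> `|z0 - Psi y| <= r /\ F (Psi y) = y.
Proof.
rewrite /V -ball_normE/= => /ltW /local_surjective[z Kz Fz].
by apply: (@xgetPex _ z0 [set z | `|z0 - z| <= r /\ F z = y]); exists z.
Qed.

(** Multiplying the first-order remainder of [F] at [Psi y] by the inverse Jacobian gives, up to
    sign, the remainder of [Psi] at [y]; [bilipschitz] converts its bound in [|Psi y' - Psi y|] into
    one in [|y' - y|]. *)
Lemma differentiable_inverse y : V y -> differentiable Psi y /\
  forall v, 'D_v Psi y = v *m invmx ('J F (Psi y)).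
Proof.
move=> Vy; have [Kz Fz] := PsiP Vy; set z := Psi y in Kz Fz *.
have [Uz uJ] := HK Kz.
pose L : {linear 'rV[R]_N -> 'rV[R]_N} := mulmxr (invmx ('J F z)).
have dF : differentiable F z := Ck_diff (HU 0%N) Uz.
apply: (differentiable_linear_approx (L := L)); first exact: mulmxr_continuous.
move=> e e0.
have nV : \forall y' \near y, V y'.
  by apply: open_nbhs_nbhs; split=> //; exact: ball_open.
pose b := N%:R * `|invmx ('J F z)| + 1.
have b0 : 0 < b by rewrite /b ltr_wpDl// mulr_ge0.
have c20 : 0 < 2 * c by rewrite mulr_gt0.
(* The tolerance anticipates the factor [2 * c] from [bilipschitz] and the factor [b] from the
   inverse Jacobian. *)
have e'0 : 0 < e / (2 * c * b) by rewrite divr_gt0// mulr_gt0.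
have Pc : Psi y' @[y' --> y] --> z.
  apply/(@cvgrPdist_le _ _ _ (nbhs y)) => d d0; near=> y'.
  have Vy' : V y' by near: y'.
  have [Kz' Fz'] := PsiP Vy'.
  rewrite distrC (le_trans (bilipschitz Kz Kz'))// Fz Fz' mulrC -ler_pdivlMr//.
  by near: y'; apply: cvgr_distC_le => //; rewrite divr_gt0.
have := Pc _ (differentiable_remainder dF e'0).
rewrite nbhs_simpl/= => nF.
near=> y'.
have Vy' : V y' by near: y'.
have [Kz' Fz'] := PsiP Vy'.
have : `|F (Psi y') - F z - 'd F z (Psi y' - z)| <= e / (2 * c * b) * `|Psi y' - z|.
  by near: y'.
rewrite Fz Fz' -deriveE// deriveEjacobian// => le1.
have -> : Psi y' - Psi y - L (y' - y) =
    - ((y' - y - (Psi y' - z) *m 'J F z) *m invmx ('J F z)).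
  by rewrite mulmxBl mulmxK// opprB.
rewrite normrN (le_trans (mx_norm_mulmx _ _))//.
have leb : N%:R * `|invmx ('J F z)| <= b by rewrite /b lerDl.
have le2 := bilipschitz Kz Kz'; rewrite Fz Fz' in le2.
rewrite (le_trans (ler_pM _ _ le1 leb)) ?mulr_ge0//.
rewrite (le_trans (ler_wpM2r (ltW b0) (ler_wpM2l (ltW e'0) le2)))//.
rewrite le_eqVlt; apply/orP; left; apply/eqP; field.
by rewrite !lt0r_neq0.
Unshelve. all: by end_near. Qed.

(* Smoothness of the inverse is obtained by bootstrapping in the identity
   D_v Psi = v ('J F \o Psi)^-1. *)
Lemma local_inverse_coordinates : local_coordinates z0 F.
Proof.
have Vo : open V by exact: ball_open.
have V0 : V (F z0) by apply: ballxx; rewrite divr_gt0// mulr_gt0.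
have cF0 : {for z0, continuous F}.
  apply/differentiable_continuous/(Ck_diff (HU 0%N)).
  by have [] := HK (z := z0); rewrite ?subrr ?normr0 ?ltW.
have nK : \forall z \near z0, `|z0 - z| <= r.
  by apply: filterS (nbhsx_ballx z0 _ r0) => z; rewrite -ball_normE => /ltW.
have nV : \forall z \near z0, V (F z) by apply: cF0; exact: open_nbhs_nbhs.
have PsiF : \forall z \near z0, Psi (F z) = z.
  apply: filterS2 nK nV => z Kz Vz; have [Kz' Fz'] := PsiP Vz.
  apply/eqP; rewrite -subr_eq0 -normr_le0 (le_trans (bilipschitz Kz Kz'))//.
  by rewrite Fz' subrr normr0 mulr0.
split.
  apply/smooth_near_CkP; exists U => //; split=> //.
  by have [] := HK (z := z0); rewrite ?subrr ?normr0 ?ltW.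
exists Psi; split=> //; last first.
  by apply: filterS (open_nbhs_nbhs (conj Vo V0)) => y /PsiP[].
apply/smooth_near_CkP; exists V => // k.
elim: k => [|k IH]; first by split=> // y /differentiable_inverse[].
split=> [y /differentiable_inverse[]//|v].
have : Ck k V (fun y => v *m invmx ('J F (Psi y))).
  apply: Ck_mulmx => //; first exact: Ck_cst.
  apply: Ck_invmx => //; first by move=> y /PsiP[/HK[]].
  apply: (@Ck_comp _ _ _ _ _ _ _ U) => //; first by move=> y /PsiP[/HK[]].
  apply/Ck_mxP => // i j.
  have [_ /(_ (delta_mx 0 i)) /(Ck_mxP _ _ Uo) /(_ 0 j)] := HU k.+1.
  apply: Ck_ext => // z Uz; rewrite deriveE ?/jacobian ?mxE//.
  exact: Ck_diff (HU 0%N) Uz.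
apply: Ck_ext => // y /differentiable_inverse[_ ->//].
Qed.

End local.

Theorem inverse_function_theorem (F : 'rV[R]_N -> 'rV[R]_N) (z0 : 'rV[R]_N) :
  smooth_near z0 F -> 'J F z0 \in unitmx -> local_coordinates z0 F.
Proof.
move=> sF uF; have [U [r [Uo r0 HU HK HC]]] := inverse_contraction sF uF.
by apply: (local_inverse_coordinates _ Uo r0 HU HK HC); rewrite unitmx_inv.
Qed.

End inverse_function.

(** * Spans of rows and columns *)

Section spans.
Variable F : fieldType.

Definition rspan (r N : nat) (M : 'M[F]_(r, N)) : {vspace 'rV[F]_N} :=
  <<[seq row i M | i : 'I_r]>>%VS.

Definition cspan (N s : nat) (M : 'M[F]_(N, s)) : {vspace 'cV[F]_N} :=
  <<[seq col j M | j : 'I_s]>>%VS.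

Lemma mem_span_codom (vT : vectType F) (I : finType) (X : I -> vT) v :
  reflect (exists c : I -> F, v = \sum_i c i *: X i) (v \in <<[seq X i | i : I]>>%VS).
Proof.
apply: (iffP idP) => [|[c ->]]; last first.
  by apply: memv_suml => i _; apply/memvZ/memv_span/codom_f.
rewrite span_def big_map big_enum/= => /memv_sumP[w wX ->].
have /choice[c Hc] : forall i, exists c, w i = c *: X i.
  by move=> i; have /vlineP[c] := wX i isT; exists c.
by exists c; apply: eq_bigr.
Qed.

Lemma mem_rspan (r N : nat) (M : 'M[F]_(r, N)) v : (v \in rspan M) = (v <= M)%MS.
Proof.
apply/mem_span_codom/submxP => [[c ->]|[c ->]].
  exists (\row_i c i); rewrite mulmx_sum_row; apply: eq_bigr => i _.
  by rewrite mxE.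
by exists (c 0); rewrite mulmx_sum_row.
Qed.

Lemma mem_cspan (N s : nat) (M : 'M[F]_(N, s)) w :
  reflect (exists c, w = M *m c) (w \in cspan M).
Proof.
have E (c : 'cV_s) : M *m c = \sum_j c j 0 *: col j M.
  apply/colP => i; rewrite !mxE summxE; apply: eq_bigr => j _.
  by rewrite !mxE mulrC.
apply: (iffP (mem_span_codom _ _)) => [[c ->]|[c ->]].
  by exists (\col_j c j); rewrite E; apply: eq_bigr => j _; rewrite mxE.
by exists (fun j => c j 0); rewrite E.
Qed.

Lemma span_rows (r N : nat) (X : 'I_r -> 'rV[F]_N) :
  <<[seq X i | i : 'I_r]>>%VS = rspan (\matrix_i X i).
Proof. by congr span; apply: eq_codom => i; rewrite rowK. Qed.

Lemma free_rows (r N : nat) (M : 'M[F]_(r, N)) :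
  free [seq row i M | i : 'I_r] = row_free M.
Proof.
have sz : size [seq row i M | i : 'I_r] == r by rewrite size_image card_ord.
apply/(@freeP _ _ _ (Tuple sz))/row_freeP => [H|[B MB] k].
  have : kermx M = 0.
    apply/row_matrixP => i; rewrite row0; apply/rowP => j.
    rewrite [RHS]mxE; move: j; apply: H.
    transitivity (row i (kermx M) *m M); last by rewrite -row_mul mulmx_ker row0.
    rewrite mulmx_sum_row; apply: eq_bigr => j _; congr (_ *: _).
    by rewrite /= (nth_map j) ?size_enum_ord// nth_ord_enum.
  by move/eqP; rewrite kermx_eq0 => /row_freeP.
move=> k0 i; have : \row_i k i *m M = 0.
  rewrite -[RHS]k0 mulmx_sum_row; apply: eq_bigr => j _; rewrite mxE.
  by rewrite /= (nth_map j) ?size_enum_ord// nth_ord_enum.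
move=> /(congr1 (mulmx^~ B)); rewrite /= -mulmxA MB mulmx1 mul0mx => /rowP/(_ i).
by rewrite !mxE.
Qed.

Lemma eqmx_rspan (r r' N : nat) (A : 'M[F]_(r, N)) (B : 'M[F]_(r', N)) :
  (A :=: B)%MS -> rspan A = rspan B.
Proof. by move=> AB; apply/vspaceP => v; rewrite !mem_rspan AB. Qed.

Lemma dim_rspan (r N : nat) (M : 'M[F]_(r, N)) : \dim (rspan M) = \rank M.
Proof.
rewrite -(eqmx_rspan (eq_row_base M)) /rspan.
have : row_free (row_base M) by exact: row_base_free.
rewrite -free_rows /free => /eqP ->.
by rewrite size_image card_ord.
Qed.

(** Transposition is an injective linear map carrying row spaces to column spaces. *)
Lemma dim_cspan (N s : nat) (M : 'M[F]_(N, s)) : \dim (cspan M) = \rank M.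
Proof.
pose T : 'Hom('rV[F]_N, 'cV[F]_N) := linfun trmx.
have -> : cspan M = (T @: rspan M^T)%VS.
  rewrite /rspan limg_span -map_comp; congr span; apply: eq_map => j.
  by rewrite /= lfunE/= -tr_col trmxK.
rewrite limg_dim_eq ?dim_rspan ?mxrank_tr//.
apply/eqP; rewrite -subv0; apply/subvP => v; rewrite memv_cap => /andP[_].
by rewrite memv_ker lfunE/= memv0 -{2}[v]trmxK => /eqP->; rewrite trmx0.
Qed.

Lemma free_cols (N s : nat) (M : 'M[F]_(N, s)) :
  free [seq col j M | j : 'I_s] -> \rank M = s.
Proof.
by rewrite /free -dim_cspan => /eqP ->; rewrite size_image card_ord.
Qed.

Lemma rank_colinj (N n : nat) (J : 'M[F]_(N, n)) (p : nat) (c : 'M[F]_(n, p)) :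
  \rank J = n -> J *m c = 0 -> c = 0.
Proof.
move=> rJ /(congr1 (mulmx (pinvmx J))); rewrite mulmxA mulVpmx ?mul1mx ?mulmx0//.
exact/eqP.
Qed.

Lemma qinv_left (N n : nat) (J : 'M[F]_(N, n)) (G : 'M[F]_(n, N)) :
  \rank J = n -> J *m G *m J = J -> G *m J = 1%:M.
Proof.
move=> rJ JGJ; apply/eqP; rewrite -subr_eq0; apply/eqP; apply: (rank_colinj rJ).
by rewrite mulmxBr mulmxA JGJ mulmx1 subrr.
Qed.

Lemma rank_mulmx_colinj (N n p : nat) (J : 'M[F]_(N, n)) (C : 'M[F]_(n, p)) :
  \rank J = n -> \rank (J *m C) = \rank C.
Proof.
move=> rJ; rewrite -mxrank_tr trmx_mul mxrankMfree ?mxrank_tr//.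
by rewrite /row_free mxrank_tr rJ.
Qed.

(** The columns of [1%:M - G *m A] span the right kernel of [A]. With a smooth quasi-inverse [G]
    this is a smooth description of the kernel. *)
Lemma rank_ker_qinv (p n : nat) (A : 'M[F]_(p, n)) (G : 'M[F]_(n, p)) :
  A *m G *m A = A -> \rank (1%:M - G *m A) = (n - \rank A)%N.
Proof.
move=> AGA; rewrite -mxrank_tr -(mxrank_tr A) -mxrank_ker.
apply/eqP; rewrite eqn_leq; apply/andP; split; apply: mxrankS.
  by rewrite sub_kermx -trmx_mul mulmxBr mulmx1 mulmxA AGA subrr trmx0.
set K := kermx _; have -> : K = K *m (1%:M - G *m A)^T; last exact: submxMl.
by rewrite linearB/= trmx1 mulmxBr mulmx1 trmx_mul mulmxA mulmx_ker mul0mx subr0.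
Qed.

End spans.

Lemma ann_rspan (R : realType) (r N : nat) (M : 'M[R]_(r, N)) w :
  w \in ann (rspan M) <-> M *m w = 0.
Proof.
rewrite mem_ann; split=> [H|H v]; last first.
  by rewrite mem_rspan => /submxP[c ->]; rewrite -mulmxA H mulmx0.
apply/row_matrixP => i; rewrite row_mul row0; apply: H.
by rewrite mem_rspan row_sub.
Qed.

(** * Adapted coordinates of a submersion *)

Section system.
Variables (R : realType) (n m : nat).

Lemma jacobian_mulmxr (p q r : nat) (g : 'rV[R]_p -> 'rV[R]_q) (B : 'M[R]_(q, r)) z :
  differentiable g z -> 'J (fun x => g x *m B) z = 'J g z *m B.
Proof.
move=> dg; have dgB := differentiable_mulmx dg (@differentiable_cst _ _ _ B z).
apply/row_matrixP => i; rewrite row_mul !rowE -!deriveEjacobian//.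
by rewrite derive_mulmx// derive_cst mulmx0 addr0.
Qed.

Lemma jacobian_id (p : nat) (z : 'rV[R]_p) : 'J id z = 1%:M.
Proof.
apply/row_matrixP => i; rewrite !rowE mulmx1 -deriveEjacobian ?derive_id//.
Qed.

Lemma jacobian_pi (z : 'rV[R]_(n + m)) :
  'J (pi_map (m := m)) z = col_mx 1%:M 0.
Proof.
have E : forall z : 'rV[R]_(n + m), pi_map z = id z *m col_mx 1%:M (0 : 'M[R]_(m, n)).
  by move=> y; rewrite -{2}[y]hsubmxK /id mul_row_col mulmx1 mulmx0 addr0.
rewrite (_ : @pi_map R n m = fun z => id z *m col_mx 1%:M (0 : 'M[R]_(m, n))); last exact/funext.
by rewrite jacobian_mulmxr// jacobian_id mul1mx.
Qed.

Lemma jacobian_row_mx (p : nat) (f : 'rV[R]_p -> 'rV[R]_n) (h : 'rV[R]_p -> 'rV[R]_m) z :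
  differentiable (fun x => row_mx (f x) (h x)) z ->
  'J (fun x => row_mx (f x) (h x)) z = row_mx ('J f z) ('J h z).
Proof.
set g := fun x => row_mx (f x) (h x) => dg.
have fE : f = (fun x => g x *m col_mx 1%:M (0 : 'M[R]_(m, n))).
  by apply/funext => x; rewrite mul_row_col mulmx1 mulmx0 addr0.
have hE : h = (fun x => g x *m col_mx (0 : 'M[R]_(n, m)) 1%:M).
  by apply/funext => x; rewrite mul_row_col mulmx1 mulmx0 add0r.
have -> : 'J f z = 'J g z *m col_mx 1%:M (0 : 'M[R]_(m, n)).
  by rewrite {1}fE; exact: jacobian_mulmxr.
have -> : 'J h z = 'J g z *m col_mx (0 : 'M[R]_(n, m)) 1%:M.
  by rewrite {1}hE; exact: jacobian_mulmxr.
rewrite -mul_mx_row.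
rewrite (_ : row_mx _ _ = 1%:M) ?mulmx1//.
by rewrite -block_mxEh -scalar_mx_block.
Qed.

Lemma rank_complement (N p : nat) (J : 'M[R]_(p + N, p)) : \rank J = p ->
  exists K : 'M[R]_(p + N, N), row_mx J K \in unitmx.
Proof.
move=> rJ; have rC : \rank (J^T)^C%MS = N.
  by rewrite mxrank_compl mxrank_tr rJ addKn.
have [K EK] : exists K : 'M[R]_(N, p + N), (K :=: J^T^C)%MS.
  (* Rewriting with [rC] gives the row basis exactly [N] rows. *)
  move: (row_base _) (eq_row_base (J^T)^C%MS) => K0; rewrite rC in K0 * => EK.
  by exists K0.
exists K^T; rewrite -unitmx_tr tr_row_mx trmxK -row_full_unit.
rewrite /row_full -addsmxE (adds_eqmx (eqmx_refl _) EK).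
exact: addsmx_compl_full.
Qed.

Section submersion.
Variables (f : 'rV[R]_(n + m) -> 'rV[R]_n) (z0 : 'rV[R]_(n + m)).
Hypotheses (sf : smooth_near z0 f).
Hypothesis rf : \forall z \near z0, \rank ('J f z) = n.

Lemma smooth_near_row_mx (V : normedModType R) (z : V) (p q : nat)
    (g : V -> 'rV[R]_p) (h : V -> 'rV[R]_q) :
  smooth_near z g -> smooth_near z h -> smooth_near z (fun x => row_mx (g x) (h x)).
Proof.
move=> sg sh; have : smooth_near z
    (fun x => g x *m row_mx 1%:M 0 + h x *m row_mx 0 1%:M).
  by apply: smooth_near_add; apply: smooth_near_mulmx => //; exact: smooth_near_cst.
apply: smooth_near_ext; apply: filterE => x.
by rewrite !mul_mx_row !mulmx1 !mulmx0 add_row_mx addr0 add0r.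
Qed.

(** The complementary functions can be taken linear: the columns of [H] complete the Jacobian of [f]
    at [z0] to an invertible matrix, and the inverse function theorem applies. *)
Lemma adapted_coordinates : exists H : 'M[R]_(n + m, m),
  local_coordinates z0 (with_coords f (fun z => z *m H)).
Proof.
have [H uH] := rank_complement (nbhs_singleton rf).
exists H; have sPhi : smooth_near z0 (with_coords f (fun z => z *m H)).
  apply: smooth_near_row_mx => //; apply: smooth_near_mulmx.
    exact: smooth_near_id.
  exact: smooth_near_cst.
apply: inverse_function_theorem => //.
rewrite jacobian_row_mx; last exact: smooth_near_diff0.
by rewrite (jacobian_mulmxr H (ex_diff (f := id))) jacobian_id mul1mx.
Qed.

(** With its converse below, this reduces projectability to the coordinate-free relation
    [v *m 'J f = a \o f]. In the adapted coordinates the remaining components are [v *m H],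
    transported by the local inverse [Psi]. *)
Lemma pushforward_fieldP v a : smooth_near z0 v -> smooth_near (f z0) a ->
  (\forall z \near z0, v z *m 'J f z = a (f z)) -> pushforward_field f z0 v a.
Proof.
move=> sv sa va; have [H cH] := adapted_coordinates.
have [sPhi [Psi [sPsi PsiPhi _]]] := cH.
have PsiPhi0 := nbhs_singleton PsiPhi.
split=> //; exists (fun z => z *m H), (fun y => v (Psi y) *m H); split=> //.
  apply: smooth_near_mulmx; last exact: smooth_near_cst.
  by apply: smooth_near_comp => //; rewrite PsiPhi0.
apply: filterS3 va (smooth_near_diff sPhi) PsiPhi => z va dPhi PsiPhiz.
rewrite jacobian_row_mx// mul_mx_row va PsiPhiz.
by rewrite (jacobian_mulmxr H (ex_diff (f := id))) jacobian_id mul1mx.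
Qed.

Lemma pushforward_fieldE v a : pushforward_field f z0 v a ->
  \forall z \near z0, v z *m 'J f z = a (f z).
Proof.
move=> [sv sa [h [b [[sPhi _] _ E]]]].
apply: filterS2 E (smooth_near_diff sPhi) => z E dPhi.
by move: E; rewrite jacobian_row_mx// mul_mx_row => /eq_row_mx[].
Qed.

(** A submersion is open: [y |-> Psi (row_mx y (z0 *m H))] is a continuous local section of [f]
    through [z0], along which properties of [f z] become properties of [y]. *)
Lemma near_image (Q : 'rV[R]_n -> Prop) :
  (\forall z \near z0, Q (f z)) -> \forall y \near f z0, Q y.
Proof.
move=> Qf; have [H [sPhi [Psi [sPsi PsiPhi PhiPsi]]]] := adapted_coordinates.
have PsiPhi0 := nbhs_singleton PsiPhi.
pose i (y : 'rV[R]_n) := row_mx y (z0 *m H).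
have si : smooth_near (f z0) i.
  by apply: smooth_near_row_mx; [exact: smooth_near_id|exact: smooth_near_cst].
have ci := smooth_near_cvg si.
have cPsi := smooth_near_cvg (smooth_near_comp si sPsi).
rewrite /= [Psi _]PsiPhi0 in cPsi.
have n1 : \forall y \near f z0, with_coords f (fun z => z *m H) (Psi (i y)) = i y.
  exact: (ci _ PhiPsi).
have n2 : \forall y \near f z0, Q (f (Psi (i y))) by exact: (cPsi _ Qf).
by apply: filterS2 n1 n2 => y /eq_row_mx[-> _].
Qed.

Lemma near_preimage (Q : 'rV[R]_n -> Prop) :
  (\forall y \near f z0, Q y) -> \forall z \near z0, Q (f z).
Proof. by move=> Qy; have cf := smooth_near_cvg sf; exact: (cf _ Qy). Qed.

End submersion.
End system.

(** * One step of the algorithms *)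

Section regularity.
Variable R : realType.

Lemma smooth_near_matrix_of_rows (V : normedModType R) (z : V) (r N : nat)
    (X : 'I_r -> V -> 'rV[R]_N) : (forall i, smooth_near z (X i)) ->
  smooth_near z (fun x => \matrix_i X i x).
Proof.
move=> sX; apply: smooth_near_mx => i j.
apply: smooth_near_ext (smooth_near_mx1 0 j (sX i)).
by apply: filterE => x; rewrite mxE.
Qed.

Lemma smooth_near_matrix_of_cols (V : normedModType R) (z : V) (s N : nat)
    (W : 'I_s -> V -> 'cV[R]_N) : (forall a, smooth_near z (W a)) ->
  smooth_near z (fun x => \matrix_(i, a) W a x i 0).
Proof.
move=> sW; apply: smooth_near_mx => i j.
apply: smooth_near_ext (smooth_near_mx1 i 0 (sW j)).
by apply: filterE => x; rewrite mxE.
Qed.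

Lemma smooth_near_row (V : normedModType R) (z : V) (p q : nat) i
    (M : V -> 'M[R]_(p, q)) :
  smooth_near z M -> smooth_near z (fun x => row i (M x)).
Proof.
move=> sM; apply: smooth_near_ext (smooth_near_mulmx
  (smooth_near_cst z (delta_mx 0 i : 'rV[R]_p)) sM).
by apply: filterE => x; rewrite -rowE.
Qed.

Lemma smooth_near_col (V : normedModType R) (z : V) (p q : nat) j
    (M : V -> 'M[R]_(p, q)) :
  smooth_near z M -> smooth_near z (fun x => col j (M x)).
Proof.
move=> sM; apply: smooth_near_ext (smooth_near_mulmx
  sM (smooth_near_cst z (delta_mx j 0 : 'cV[R]_q))).
by apply: filterE => x; rewrite -colE.
Qed.

Lemma regular_near_rows (N : nat) (z : 'rV[R]_N) (E : tdistribution R N) :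
  regular_near z E -> exists (r : nat) (X : 'rV[R]_N -> 'M[R]_(r, N)),
  [/\ smooth_near z X, \forall x \near z, E x = rspan (X x)
    & \forall x \near z, \rank (X x) = \rank (X z)].
Proof.
move=> [[r [X [sX EX]]] dE]; exists r, (fun x => \matrix_i X i x).
have EX' : \forall x \near z, E x = rspan (\matrix_i X i x).
  by apply: filterS EX => x ->; rewrite span_rows.
split=> //; first exact: smooth_near_matrix_of_rows.
have EXz := nbhs_singleton EX'.
by apply: filterS2 EX' dE => x EXx; rewrite -!dim_rspan -EXx -EXz.
Qed.

Lemma rspan_regular (N r : nat) (z : 'rV[R]_N) (L : 'rV[R]_N -> 'M[R]_(r, N)) :
  smooth_near z L -> (\forall x \near z, \rank (L x) = \rank (L z)) ->
  regular_near z (fun x => rspan (L x)).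
Proof.
move=> sL rL; split; last by apply: filterS rL => x; rewrite !dim_rspan.
exists r, (fun i x => row i (L x)); split; last exact: filterE.
by move=> i; exact: smooth_near_row.
Qed.

Lemma cspan_regular (N s : nat) (z : 'rV[R]_N) (C : 'rV[R]_N -> 'M[R]_(N, s)) :
  smooth_near z C -> (\forall x \near z, \rank (C x) = \rank (C z)) ->
  regular_near z (fun x => cspan (C x)).
Proof.
move=> sC rC; split; last by apply: filterS rC => x; rewrite !dim_cspan.
exists s, (fun i x => col i (C x)); split; last exact: filterE.
by move=> i; exact: smooth_near_col.
Qed.

End regularity.

(** * Invariance of the pulled-back annihilator *)

Section step.
Variables (R : realType) (n m : nat).
Variables (f : 'rV[R]_(n + m) -> 'rV[R]_n) (z0 : 'rV[R]_(n + m)).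
Hypotheses (sf : smooth_near z0 f).
Hypothesis rf : \forall z \near z0, \rank ('J f z) = n.

Lemma mem_coann_dspan z v : v \in coann (dspan f z) -> v *m 'J f z = 0.
Proof.
move=> /mem_coann vK; apply/row_matrixP => k; rewrite ord1 row0 row_id.
apply/rowP => j; transitivity ((v *m col j ('J f z)) 0 0).
  by rewrite colE mulmxA -colE [RHS]mxE.
by rewrite vK ?mxE//; exact/memv_span/codom_f.
Qed.

(* The Lie derivatives of df^1, ..., df^n along ker f_* vanish. *)
Lemma lie_derivative_jacobian z (v : 'rV[R]_(n + m) -> 'rV[R]_(n + m)) :
  smooth_near z f -> smooth_near z v ->
  (\forall x \near z, v x *m 'J f x = 0) ->
  'D_(v z) (fun x => 'J f x) z + 'J v z *m 'J f z = 0.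
Proof.
move=> sfz sv vJ; have dJ := smooth_near_diff0 (smooth_near_jacobian sfz).
have dv := smooth_near_diff0 sv.
apply/row_matrixP => i; rewrite linearD/= row0 row_mul (rowE i ('J v z)) -(deriveEjacobian _ dv).
have E u u' : u *m 'D_u' (fun x => 'J f x) z = 'D_u' ('D_u f) z.
  have du := @differentiable_cst _ _ _ u z.
  transitivity ('D_u' (fun x => u *m 'J f x) z).
    by rewrite (derive_mulmx _ du dJ) derive_cst mul0mx add0r.
  apply: near_eq_derive; apply: filterS (smooth_near_diff sfz) => x dfx.
  by rewrite deriveEjacobian.
rewrite rowE.
have -> : delta_mx 0 i *m 'D_(v z) (fun x => 'J f x) z =
    v z *m 'D_(delta_mx 0 i) (fun x => 'J f x) z.
  apply: (etrans (E _ _)); apply: (etrans _ (esym (E _ _))).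
  exact: smooth_derive_comm.
rewrite addrC; apply: (etrans (esym (derive_mulmx (delta_mx 0 i) dv dJ))).
apply: (etrans (near_eq_derive (g := cst 0) _ _)); first exact: vJ.
exact: derive_cst.
Qed.

(* C is f^* (ann Delta), where Delta is spanned by the rows of A. *)
Lemma pullback_ann_codist (r : nat) (A : 'rV[R]_n -> 'M[R]_(r, n)) :
  smooth_near (f z0) A ->
  (\forall y \near f z0, \rank (A y) = \rank (A (f z0))) ->
  exists C : codistribution R (n + m),
    [/\ regular_near z0 C, invariant_codist z0 C (fun z => coann (dspan f z))
      & \forall z \near z0, forall w, w \in C z <->
          exists2 c, w = 'J f z *m c & A (f z) *m c = 0].
Proof.
move=> sA rA; have sJ := smooth_near_jacobian sf.
have [G [sG AGA]] := const_rank_qinv sA rA.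
pose Cd y : 'M[R]_n := 1%:M - G y *m A y.
have sCd : smooth_near (f z0) Cd.
  apply: (@smooth_near_ext _ _ _ _ (fun y => 1%:M + (- 1%:M) *m G y *m A y)).
    by apply: filterE => y; rewrite mulNmx mul1mx mulNmx.
  apply: smooth_near_add; first exact: smooth_near_cst.
  apply: smooth_near_mulmx => //; apply: smooth_near_mulmx => //.
  exact: smooth_near_cst.
have AGAf := near_preimage sf AGA.
have memC : \forall z \near z0, forall w, w \in cspan ('J f z *m Cd (f z)) <->
          exists2 c, w = 'J f z *m c & A (f z) *m c = 0.
  apply: filterS AGAf => z AGAz w; split=> [/mem_cspan[c ->]|[c -> Ac]].
    exists (Cd (f z) *m c); first by rewrite mulmxA.
    by rewrite mulmxA mulmxBr mulmx1 mulmxA AGAz subrr mul0mx.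
  apply/mem_cspan; exists c; rewrite -mulmxA mulmxBl mul1mx -(mulmxA (G _)) Ac.
  by rewrite mulmx0 subr0.
exists (fun z => cspan ('J f z *m Cd (f z))); split=> //.
  apply: cspan_regular.
    by apply: smooth_near_mulmx => //; exact: smooth_near_comp.
  have rC : \forall z \near z0, \rank ('J f z *m Cd (f z)) = (n - \rank (A (f z0)))%N.
    apply: filterS3 rf AGAf (near_preimage sf rA) => z rfz AGAz <-.
    by rewrite rank_mulmx_colinj// rank_ker_qinv.
  by have rC0 := nbhs_singleton rC; apply: filterS rC => z ->; rewrite rC0.
move=> v w sv sw vK wC.
have rJ : \forall z \near z0, \rank ('J f z) = \rank ('J f z0).
  have rf0 : \rank ('J f z0) = n := nbhs_singleton rf.
  by apply: filterS rf => z rfz; exact: etrans rfz (esym rf0).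
have [JL [sJL JJJ]] := const_rank_qinv sJ rJ.
(* Since ['J f z] has full column rank, its quasi-inverse is a left inverse, so the coefficients of
   [w] with respect to the [df^i] are smooth. *)
pose c z := JL z *m w z.
have sc : smooth_near z0 c by exact: smooth_near_mulmx.
have wE : \forall z \near z0, w z = 'J f z *m c z /\ A (f z) *m c z = 0.
  apply: filterS2 (filterI wC memC) (filterI rf JJJ) => z [wCz memCz] [rfz JJJz].
  have [cz wz Acz] := (memCz _).1 wCz.
  suff -> : c z = cz by [].
  by rewrite /c wz mulmxA (qinv_left rfz JJJz) mul1mx.
have vJ : \forall z \near z0, v z *m 'J f z = 0.
  by apply: filterS vK => z /mem_coann_dspan.
have sAf : smooth_near z0 (fun z => A (f z)) by exact: smooth_near_comp.
(* To be differentiated at [z], the identities must hold on a neighborhood of every nearby [z]. *)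
have nn (Q : 'rV[R]_(n + m) -> Prop) : (\forall z \near z0, Q z) ->
    \forall z \near z0, \forall x \near z, Q x by move=> H; exact: nbhs_interior.
apply: filterS3 (filterI memC (filterI (nn _ wE) (nn _ vJ)))
  (filterI (smooth_near_near sf) (filterI (smooth_near_near sv) (smooth_near_near sc)))
  (filterI (smooth_near_near sJ) (filterI (smooth_near_near sAf) (near_preimage sf (smooth_near_diff sA))))
  => z [memCz [wEz vJz]] [sfz [svz scz]] [sJz [sAfz dAz]].
have dJ := smooth_near_diff0 sJz; have dc := smooth_near_diff0 scz.
have dAf := smooth_near_diff0 sAfz; have df := smooth_near_diff0 sfz.
apply/memCz; exists ('D_(v z) c z).
  rewrite /lie_derivative.
  have -> : 'D_(v z) w z = 'D_(v z) (fun x => 'J f x *m c x) z.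
    by apply: near_eq_derive; apply: filterS wEz => x [].
  rewrite (derive_mulmx _ dJ dc) (nbhs_singleton wEz).1 mulmxA addrAC -mulmxDl.
  by rewrite lie_derivative_jacobian// mul0mx add0r.
have H0 : 'D_(v z) (fun x => A (f x) *m c x) z = 0.
  apply: (etrans (near_eq_derive (g := cst 0) _ _)); last exact: derive_cst.
  by apply: filterS wEz => x [].
rewrite (derive_mulmx _ dAf dc) in H0.
(* [A \o f] is constant to first order along [v], because [f_* v = 0]; so differentiating
   [A (f z) *m c z = 0] keeps ['D_(v z) c z] in the kernel of [A (f z)]. *)
have E0 : 'D_(v z) (fun x => A (f x)) z = 0.
  rewrite (deriveE _ dAf) (@diff_comp _ _ _ _ f A)//=.
  by rewrite -(deriveE _ df) deriveEjacobian// (nbhs_singleton vJz) linear0.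
by move: H0; rewrite E0 mul0mx add0r.
Qed.

End step.

(** * Lifting to projectable fields, and the inductive step *)

Section step.
Variables (R : realType) (n m : nat).
Variables (f : 'rV[R]_(n + m) -> 'rV[R]_n) (z0 : 'rV[R]_(n + m)).
Hypotheses (sf : smooth_near z0 f).
Hypothesis rf : \forall z \near z0, \rank ('J f z) = n.

Lemma mulmx_eq0_col (p q r : nat) (A : 'M[R]_(p, q)) (B : 'M[R]_(q, r)) :
  (forall j, A *m col j B = 0) -> A *m B = 0.
Proof.
move=> AB; apply/matrixP => i j; transitivity ((A *m col j B) i 0).
  by rewrite colE mulmxA -colE [RHS]mxE.
by rewrite AB !mxE.
Qed.

(** The columns of [1 - G *m A] lie in the right kernel of [A], hence in that of [B]. So [B *m G] is
    a solution [Y] of [Y *m A = B], smooth as soon as [B] and [G] are. *)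
Lemma qinv_mulmx (p q r : nat) (A : 'M[R]_(p, q)) (B : 'M[R]_(r, q)) :
  (forall c : 'cV_q, A *m c = 0 -> B *m c = 0) -> forall G, A *m G *m A = A ->
  B *m G *m A = B.
Proof.
move=> AB G AGA; apply/eqP; rewrite -subr_eq0 -oppr_eq0 opprB; apply/eqP.
rewrite -mulmxA -{1}[B]mulmx1 -mulmxBr.
apply: mulmx_eq0_col => j; apply: AB.
by rewrite colE mulmxA mulmxBr mulmx1 mulmxA AGA subrr mul0mx.
Qed.

(** This is the converse half of the idea. By hypothesis the right kernel of [X *m 'J f] lies in the
    column space of [W \o f], which [B \o f] kills; constant rank provides a smooth quasi-inverse
    [G1], and [L = (B \o f) *m G1 *m X] solves [L *m 'J f = B \o f]. *)
Lemma projectable_lift (e s : nat) (X : 'rV[R]_(n + m) -> 'M[R]_(e, n + m))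
    (W : 'rV[R]_n -> 'M[R]_(n, s)) :
  smooth_near z0 X -> smooth_near (f z0) W ->
  (\forall z \near z0, \rank (X z *m 'J f z) = \rank (X z0 *m 'J f z0)) ->
  (\forall y \near f z0, \rank (W y) = \rank (W (f z0))) ->
  (\forall z \near z0, forall c : 'cV_n, X z *m 'J f z *m c = 0 ->
     exists d, c = W (f z) *m d) ->
  exists (g : nat) (B : 'rV[R]_n -> 'M[R]_(g, n))
    (L : 'rV[R]_(n + m) -> 'M[R]_(g, n + m)),
  [/\ regular_near z0 (fun z => rspan (L z)),
      projectable f z0 (fun z => rspan (L z)),
      sub_near z0 (fun z => rspan (L z)) (fun z => rspan (X z)),
      \forall z \near z0, L z *m 'J f z = B (f z)
    & \forall y \near f z0, forall c : 'cV_n, B y *m c = 0 ->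
        exists d, c = W y *m d].
Proof.
move=> sX sW rXJ rW XJW; have sJ := smooth_near_jacobian sf.
have [GW [sGW WGW]] := const_rank_qinv sW rW.
(* The rows of [K y] span the vectors killed by [W y], and the right kernel of [K y] is exactly the
   column space of [W y]. *)
pose K y : 'M[R]_n := 1%:M - W y *m GW y.
have sK : smooth_near (f z0) K.
  apply: (@smooth_near_ext _ _ _ _ (fun y => 1%:M + (- 1%:M) *m W y *m GW y)).
    by apply: filterE => y; rewrite mulNmx mul1mx mulNmx.
  apply: smooth_near_add; first exact: smooth_near_cst.
  apply: smooth_near_mulmx => //; apply: smooth_near_mulmx => //.
  exact: smooth_near_cst.
have rK : \forall y \near f z0, \rank (K y) = (n - \rank (W (f z0)))%N.
  apply: filterS2 WGW rW => y WGWy <-.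
  rewrite -mxrank_tr -(mxrank_tr (W y)) linearB/= trmx1 trmx_mul.
  by apply: rank_ker_qinv; rewrite -!trmx_mul mulmxA WGWy.
have rK' : \forall y \near f z0, \rank (K y) = \rank (K (f z0)).
  by have rK0 := nbhs_singleton rK; apply: filterS rK => y ->; rewrite rK0.
have [S SK] := const_rank_basis sK rK'.
move: (\rank (K (f z0))) rK' S SK => g rK' S SK.
pose B y := S *m K y.
have sB : smooth_near (f z0) B.
  by apply: smooth_near_mulmx => //; exact: smooth_near_cst.
(* Independent rows of [B] force independent rows of [L], which [projectable] demands of a basis. *)
have fB : \forall y \near f z0, row_free (B y).
  by apply: filterS2 SK rK' => y SKy rKy; rewrite /row_free /B SKy rKy.
have KW : \forall y \near f z0, K y *m W y = 0.
  by apply: filterS WGW => y WGWy; rewrite mulmxBl mul1mx WGWy subrr.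
have sXJ : smooth_near z0 (fun z => X z *m 'J f z) by exact: smooth_near_mulmx.
have [G1 [sG1 XJG]] := const_rank_qinv sXJ rXJ.
pose L z := B (f z) *m G1 z *m X z.
have sL : smooth_near z0 L.
  by do 2?[apply: smooth_near_mulmx => //]; exact: smooth_near_comp.
have LJ : \forall z \near z0, L z *m 'J f z = B (f z).
  apply: filterS3 (near_preimage sf KW) XJG XJW => z KWz XJGz XJWz.
  rewrite /L -mulmxA; apply: qinv_mulmx XJGz => c /XJWz[d ->].
  by rewrite /B mulmxA -(mulmxA S) KWz mulmx0 mul0mx.
have fL : \forall z \near z0, \rank (L z) = g.
  apply: filterS2 LJ (near_preimage sf fB) => z LJz /eqP fBz.
  apply/eqP; rewrite eqn_leq rank_leq_row/= -[leqLHS]fBz -LJz.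
  exact: mxrankM_maxl.
have fL0 := nbhs_singleton fL.
exists g, B, L; split=> //.
- apply: rspan_regular => //.
  by apply: filterS fL => z fLz; exact: etrans fLz (esym fL0).
- exists g, (fun i z => row i (L z)); split.
    move=> i; exists (fun y => row i (B y)); apply: pushforward_fieldP => //.
    + exact: smooth_near_row.
    + exact: smooth_near_row.
    + by apply: filterS LJ => z LJz; rewrite -LJz row_mul.
  apply: filterS fL => z fLz; rewrite /basis_of eqxx/= free_rows.
  by rewrite /row_free fLz.
- apply: filterE => z; apply/subvP => v; rewrite !mem_rspan => /submx_trans; apply.
  exact: submxMl.
- apply: filterS SK => y SKy c Bc; exists (GW y *m c).
  have Kc : K y *m c = 0.
    have /submxP[Y ->] : (K y <= B y)%MS by rewrite /B SKy.
    by rewrite -mulmxA Bc mulmx0.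
  by apply/eqP; rewrite mulmxA -subr_eq0 -{1}[c]mul1mx -mulmxBl Kc.
Qed.

(** [A W = 0] and the inclusion of [ker A] in the column space of [W] are proved at points [f z],
    carried to all [y] near [f z0] by [near_image], and then read at [lsubmx z]. *)
Lemma step_ann E E' P P' :
  f z0 = lsubmx z0 -> regular_near z0 E ->
  (\forall z \near z0, P z = ann (E z)) ->
  step_A f z0 E E' -> step_B f z0 P P' ->
  \forall z \near z0, P' z = ann (E' z).
Proof.
move=> fz0 regE PE [D [Delta [[regD projD subDE maxD] pushD regDelta E'E regE']]].
move=> [Pp [regQ [regPp invPp subQPp minPp] shiftPp regP']].
have [e [X [sX EX rX]]] := regular_near_rows regE.
have [r [v [a [pva basisD DeltaE]]]] := pushD.
have [s [w [sw basisPp P'E]]] := shiftPp.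
have sJ := smooth_near_jacobian sf.
pose A y := \matrix_i a i y.
have sA : smooth_near (f z0) A.
  by apply: smooth_near_matrix_of_rows => i; have [] := pva i.
have {}DeltaE : \forall y \near f z0, Delta y = rspan (A y).
  by apply: filterS DeltaE => y ->; rewrite span_rows.
have rA : \forall y \near f z0, \rank (A y) = \rank (A (f z0)).
  have DeltaE0 := nbhs_singleton DeltaE.
  apply: filterS2 DeltaE regDelta.2 => y Dy.
  by rewrite -!dim_rspan -Dy -DeltaE0.
pose W y := \matrix_(i, b) w b y i 0.
have sW : smooth_near (f z0) W by exact: smooth_near_matrix_of_cols.
pose V z := \matrix_i v i z.
have DV : \forall z \near z0, D z = rspan (V z).
  by apply: filterS basisD => z /andP[/eqP <- _]; rewrite -span_rows.
have VJ : \forall z \near z0, V z *m 'J f z = A (f z).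
  have := @filter_forall _ 'I_r (fun i z => v i z *m 'J f z = a i (f z)) (nbhs z0)
    (nbhs_filter z0) (fun i => pushforward_fieldE (pva i)).
  apply: (@filterS _ (nbhs z0)) => z vaz; apply/row_matrixP => i.
  by rewrite row_mul !rowK.
have pbE (g : 'rV[R]_(n + m) -> 'rV[R]_n) z :
    [seq pullback_form g (w b) z | b : 'I_s] = [seq col b ('J g z *m W (g z)) | b : 'I_s].
  apply: eq_codom => b; rewrite /pullback_form colE -mulmxA -colE; congr (_ *m _).
  by apply/colP => i; rewrite !mxE.
have PpW : \forall z \near z0, Pp z = cspan ('J f z *m W (f z)) /\ \rank (W (f z)) = s.
  apply: filterS2 basisPp rf => z; rewrite pbE => /andP[/eqP <- /free_cols rJW] rfz.
  by split=> //; rewrite -[RHS]rJW rank_mulmx_colinj.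
have memQ : \forall z \near z0, forall u, u \in (P z :&: dspan f z)%VS <->
    exists2 c, u = 'J f z *m c & X z *m 'J f z *m c = 0.
  apply: filterS2 PE EX => z Pz Ez u; rewrite memv_cap Pz Ez; split.
    move=> /andP[/ann_rspan Xu /mem_cspan[c uc]]; exists c => //.
    by rewrite -mulmxA -uc.
  move=> [c -> Xc]; apply/andP; split; last by apply/mem_cspan; exists c.
  by apply/ann_rspan; rewrite mulmxA.
(* [P] meets [span {df}] in the image under the injective ['J f z] of the right kernel of
   [X z *m 'J f z]. Its dimension is constant by the regularity required in [step_B], hence so is
   the rank. *)
have rXJ : \forall z \near z0, \rank (X z *m 'J f z) = \rank (X z0 *m 'J f z0).
  have dQ : \forall z \near z0, \dim (P z :&: dspan f z)%VS = (n - \rank (X z *m 'J f z))%N.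
    apply: filterS2 memQ rf => z memQz rfz.
    pose K := kermx (X z *m 'J f z)^T.
    have rK : \rank K^T = (n - \rank (X z *m 'J f z))%N.
      by rewrite mxrank_tr mxrank_ker mxrank_tr.
    rewrite -rK -(rank_mulmx_colinj _ rfz) -dim_cspan; congr (\dim _).
    apply/vspaceP => u; apply/idP/mem_cspan => [/memQz[c -> XJc]|[c ->]].
      have /submxP[Y cY] : (c^T <= K)%MS by rewrite sub_kermx -trmx_mul XJc trmx0.
      by exists Y^T; rewrite -mulmxA -trmx_mul -cY trmxK.
    apply/memQz; exists (K^T *m c); first by rewrite -mulmxA.
    have KM : X z *m 'J f z *m K^T = 0.
      by rewrite -[_ *m 'J f z]trmxK -trmx_mul mulmx_ker trmx0.
    by rewrite mulmxA KM mul0mx.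
  have dQ0 := nbhs_singleton dQ.
  apply: filterS2 dQ regQ.2 => z dz dz'.
  have subnI (k k' : nat) : (k <= n)%N -> (k' <= n)%N -> (n - k = n - k')%N -> k = k'.
    by move=> kn k'n H; rewrite -(subKn kn) H subKn.
  exact: (subnI _ _ (rank_leq_col _) (rank_leq_col _) (etrans (esym dz) (etrans dz' dQ0))).
have [C [regC invC memC]] := pullback_ann_codist sf rf sA rA.
have subQC : sub_near z0 (fun z => (P z :&: dspan f z)%VS) C.
  apply: filterS3 memQ (filterI memC VJ) (filterI subDE (filterI DV EX)) => z memQz [memCz VJz] [DEz [DVz EXz]].
  apply/subvP => u /memQz[c -> XJc]; apply/memCz; exists c => //.
  have /submxP[Y VY] : (V z <= X z)%MS.
    apply/row_subP => i; rewrite -mem_rspan -EXz; apply: (subvP DEz).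
    by rewrite DVz mem_rspan row_sub.
  by rewrite -VJz VY -!(mulmxA Y) XJc mulmx0.
have AW : \forall y \near f z0, A y *m W y = 0.
  apply: (near_image sf rf).
  apply: filterS3 (minPp C regC invC subQC) memC (filterI PpW rf) => z PpC memCz [[PpWz _] rfz].
  apply: mulmx_eq0_col => b.
  have /(subvP PpC) /memCz[c Wc Ac] : col b ('J f z *m W (f z)) \in Pp z.
    by rewrite PpWz; exact/memv_span/codom_f.
  suff -> : col b (W (f z)) = c by [].
  apply/eqP; rewrite -subr_eq0; apply/eqP; apply: (rank_colinj rfz).
  by rewrite mulmxBr -Wc !colE mulmxA subrr.
have lift : \forall z \near z0, forall c : 'cV_n, X z *m 'J f z *m c = 0 ->
     exists d, c = W (f z) *m d.
  apply: filterS3 memQ subQPp (filterI PpW rf) => z memQz QPp [[PpWz _] rfz] c XJc.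
  have : 'J f z *m c \in Pp z by apply: (subvP QPp); apply/memQz; exists c.
  rewrite PpWz => /mem_cspan[d]; rewrite -mulmxA => /eqP.
  rewrite -subr_eq0 -mulmxBr => /eqP /(rank_colinj rfz) /eqP.
  by rewrite subr_eq0 => /eqP ->; exists d.
(* The forms used by the backward shift are a basis of [Pp], so [W] has full column rank [s]. *)
have rW : \forall y \near f z0, \rank (W y) = \rank (W (f z0)).
  have rWs : \forall y \near f z0, \rank (W y) = s.
    by apply: (near_image sf rf); apply: filterS PpW => z [].
  have rW0 := nbhs_singleton rWs.
  by apply: filterS rWs => y ->; rewrite rW0.
have [g [B [L [regL projL subLX LJ BW]]]] := projectable_lift sX sW rXJ rW lift.
have subLE : sub_near z0 (fun z => rspan (L z)) E.
  by apply: filterS2 subLX EX => z LXz ->.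
have AcW : \forall y \near f z0, forall c : 'cV_n, A y *m c = 0 -> exists d, c = W y *m d.
  apply: (near_image sf rf).
  apply: filterS3 (maxD _ regL projL subLE) (near_preimage sf BW) (filterI DV (filterI VJ LJ)) =>
    z LDz BWz [DVz [VJz LJz]] c Ac; apply: BWz.
  have /submxP[Y LY] : (L z <= V z)%MS.
    by apply/row_subP => i; rewrite -mem_rspan -DVz; apply: (subvP LDz); rewrite mem_rspan row_sub.
  by rewrite -LJz LY -(mulmxA Y) VJz -mulmxA Ac mulmx0.
(* The equilibrium enters here: [f] and [pi_map] take the same value at [z0], so what holds near
   [f z0] holds at [lsubmx z] for [z] near [z0]. *)
have piz : \forall z \near z0, [/\ A (lsubmx z) *m W (lsubmx z) = 0,
    forall c : 'cV_n, A (lsubmx z) *m c = 0 -> exists d, c = W (lsubmx z) *m d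
    & Delta (lsubmx z) = rspan (A (lsubmx z))].
  have cpi : lsubmx z @[z --> z0] --> f z0 by rewrite fz0; exact: continuous_lsubmx.
  have H : \forall y \near f z0, [/\ A y *m W y = 0,
      forall c : 'cV_n, A y *m c = 0 -> exists d, c = W y *m d
      & Delta y = rspan (A y)] by apply: filterS3 AW AcW DeltaE.
  exact: (cpi _ H).
apply: filterS3 piz P'E E'E => z [AWz AcWz Dz] -> E'z.
rewrite pbE -/(cspan _) jacobian_pi.
have memE' u : u \in E' z = (u *m col_mx 1%:M 0 <= A (lsubmx z))%MS.
  by rewrite E'z /preimage_dist -memv_preim lfunE/= jacobian_pi -mem_rspan Dz.
apply/vspaceP => u; apply/mem_cspan/idP => [[d ->]|/mem_ann uE'].
  apply/mem_ann => x.
  rewrite memE' => /submxP[Y xY].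
  by rewrite -mulmxA (mulmxA x) xY mulmxA -(mulmxA Y) AWz mulmx0 mul0mx.
(* The vertical vectors [row_mx 0 (delta_mx 0 i)] belong to [E' z], so [u] has no [du] part. *)
have u2 : dsubmx u = 0.
  apply/row_matrixP => i; rewrite row0.
  have := uE' (row_mx 0 (delta_mx 0 i)).
  rewrite memE' mul_row_col mul0mx mulmx0 addr0 sub0mx => /(_ isT).
  by rewrite -[u]vsubmxK mul_row_col mul0mx add0r col_mxKd -rowE.
(* Testing [u] on the rows of [A], extended by zero, shows that its [dx] part is killed by [A]. *)
have [|d ud] := AcWz (usubmx u).
  apply/row_matrixP => i; rewrite row0 row_mul.
  have := uE' (row_mx (row i (A (lsubmx z))) 0).
  rewrite memE' mul_row_col mulmx1 mul0mx addr0 row_sub => /(_ isT).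
  by rewrite -{1}[u]vsubmxK mul_row_col mul0mx addr0.
exists d; rewrite -mulmxA -ud mul_col_mx mul1mx mul0mx.
by rewrite -[u in LHS]vsubmxK u2.
Qed.

End step.

(** * Runs of the algorithms *)

Section run.
Variables (R : realType) (n m : nat).
Variables (f : 'rV[R]_(n + m) -> 'rV[R]_n) (z0 : 'rV[R]_(n + m)).
Hypotheses (sf : smooth_near z0 f).
Hypothesis rf : \forall z \near z0, \rank ('J f z) = n.
Hypothesis fz0 : f z0 = lsubmx z0.

Lemma vspace_rspan (N : nat) (A : {vspace 'rV[R]_N}) :
  A = rspan (\matrix_(i < \dim A) tnth (vbasis A) i).
Proof.
rewrite -span_rows -[LHS](span_basis (vbasisP A)); congr span.
by rewrite /image_mem -[LHS]map_tnth_enum.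
Qed.

(** The columns of the cokernel matrix of a basis of [A] annihilate [A], hence [B], and a vector
    they all kill lies in [A]. *)
Lemma ann_subv (N : nat) (A B : {vspace 'rV[R]_N}) :
  (ann A <= ann B)%VS -> (B <= A)%VS.
Proof.
rewrite (vspace_rspan A); set M := \matrix_i _ => AB.
apply/subvP => v vB; rewrite mem_rspan submxE; apply/eqP.
apply: mulmx_eq0_col => j; have /(subvP AB) : col j (cokermx M) \in ann (rspan M).
  by apply/ann_rspan; rewrite colE mulmxA mulmx_coker mul0mx.
by move=> /mem_ann; apply.
Qed.

Lemma ann_inj (N : nat) (A B : {vspace 'rV[R]_N}) : ann A = ann B -> A = B.
Proof.
move=> AB; apply: subv_anti; apply/andP.
by split; apply: ann_subv; rewrite AB subvv.
Qed.

Lemma span_duE (z : 'rV[R]_(n + m)) : span_du z = rspan (row_mx 0 1%:M : 'M[R]_(m, n + m)).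
Proof.
rewrite /span_du span_rows; congr rspan; apply/row_matrixP => i.
by rewrite rowK delta_mx_rshift row_row_mx row0 rowE mulmx1.
Qed.

Lemma ann_span_du (z : 'rV[R]_(n + m)) : ann (span_du z) = dspan (pi_map (R := R) (n := n) (m := m)) z.
Proof.
rewrite /dspan -/(cspan _) jacobian_pi span_duE.
apply/vspaceP => u; apply/idP/mem_cspan => [/ann_rspan|[c ->]].
  rewrite -{1}[u]vsubmxK mul_row_col mul0mx mul1mx add0r => u2.
  by exists (usubmx u); rewrite mul_col_mx mul1mx mul0mx -u2 vsubmxK.
apply/ann_rspan; rewrite mulmxA mul_row_col mul0mx mulmx0 addr0 mul0mx//.
Qed.

Lemma span_du_regular : regular_near z0 (@span_du R n m).
Proof.
split; last exact: filterE.
exists m, (fun j _ => delta_mx 0 (rshift n j)); split; last exact: filterE.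
by move=> i; exact: smooth_near_cst.
Qed.

Lemma regular_near_ext (N p q : nat) (z : 'rV[R]_N)
    (D D' : 'rV[R]_N -> {vspace 'M[R]_(p, q)}) :
  (\forall x \near z, D x = D' x) -> regular_near z D' -> regular_near z D.
Proof.
move=> DD' [[r [X [sX D'X]]] dD']; split.
  by exists r, X; split=> //; apply: filterS2 DD' D'X => x ->.
have DDz := nbhs_singleton DD'.
by apply: filterS2 DD' dD' => x ->; rewrite DDz.
Qed.

(** A pointwise description of the pushforward, free of the chosen basis, so that pushforwards of
    nested distributions can be compared. *)
Lemma pushforward_distE D Delta : pushforward_dist f z0 D Delta ->
  \forall z \near z0, forall d, d \in Delta (f z) <->
    exists2 v, v \in D z & d = v *m 'J f z.
Proof.
move=> [r [v [a [pva basisD DeltaE]]]].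
have VJi := @filter_forall _ 'I_r (fun i z => v i z *m 'J f z = a i (f z)) (nbhs z0)
    (nbhs_filter z0) (fun i => pushforward_fieldE (pva i)).
apply: filterS3 VJi basisD (near_preimage sf DeltaE) => z VJz /andP[/eqP Dz _] Deltaz d.
rewrite Deltaz; split=> [/mem_span_codom[c ->]|[x]].
  exists (\sum_i c i *: v i z).
    by rewrite -Dz; apply/mem_span_codom; exists c.
  by rewrite mulmx_suml; apply: eq_bigr => i _; rewrite -scalemxAl VJz.
rewrite -Dz => /mem_span_codom[c ->] ->; apply/mem_span_codom; exists c.
by rewrite mulmx_suml; apply: eq_bigr => i _; rewrite -scalemxAl VJz.
Qed.

Lemma near_pi (Q : 'rV[R]_n -> Prop) :
  (\forall y \near f z0, Q y) -> \forall z \near z0, Q (pi_map z).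
Proof.
have cpi : pi_map z @[z --> z0] --> f z0 by rewrite fz0; exact: continuous_lsubmx.
by move=> H; exact: (cpi _ H).
Qed.

(** The projectable [D] inside [E1] also lies in [E2], hence in the largest projectable [D'];
    pushforward and preimage preserve the inclusion. *)
Lemma step_A_mono E1 E2 E3 : sub_near z0 E1 E2 ->
  step_A f z0 E1 E2 -> step_A f z0 E2 E3 -> sub_near z0 E2 E3.
Proof.
move=> E12 [D [Delta [[regD projD subD _] pushD _ E2E _]]].
move=> [D' [Delta' [[_ _ _ maxD'] pushD' _ E3E _]]].
have DE2 : sub_near z0 D E2.
  by apply: filterS2 subD E12 => z; exact: subv_trans.
have DD' := maxD' _ regD projD DE2.
have DD : \forall y \near f z0, (Delta y <= Delta' y)%VS.
  apply: (near_image sf rf).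
  apply: filterS3 DD' (pushforward_distE pushD) (pushforward_distE pushD') =>
    z DDz Dz Dz'.
  apply/subvP => d /Dz[x xD ->]; apply/Dz'; exists x => //.
  exact: (subvP DDz).
apply: filterS3 (near_pi DD) E2E E3E => z DDz -> ->.
by apply/subvP => x; rewrite -!memv_preim; exact: (subvP DDz).
Qed.

(** The fields [d_u] are killed by the differential of [pi_map], so every preimage contains them. *)
Lemma step_A_first E E' : (\forall z \near z0, E z = span_du z) ->
  step_A f z0 E E' -> sub_near z0 E E'.
Proof.
move=> EE [D [Delta [_ _ _ E'E _]]]; apply: filterS2 EE E'E => z -> ->.
apply/subvP => x; rewrite span_duE mem_rspan => /submxP[c ->].
rewrite -memv_preim lfunE/= jacobian_pi -mulmxA mul_row_col mul0mx mulmx0 addr0.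
by rewrite mulmx0 mem0v.
Qed.

Variables (kA kB : nat) (E : nat -> tdistribution R (n + m)).
Variable P : nat -> codistribution R (n + m).
Hypotheses (runA : algorithm_A f z0 kA E) (runB : algorithm_B f z0 kB P).

Lemma run_regular k : (k <= kA)%N -> regular_near z0 (E k).
Proof.
have [_ E0 stepA _] := runA.
case: k => [_|k kA']; first exact: regular_near_ext E0 span_du_regular.
by have [D [Delta []]] := stepA k.+1 kA'.
Qed.

Lemma run_mono k : (k < kA)%N -> sub_near z0 (E k) (E k.+1).
Proof.
have [_ E0 stepA _] := runA.
elim: k => [|k IH] kA'; first exact: step_A_first E0 (stepA 1%N kA').
exact: step_A_mono (IH (ltnW kA')) (stepA k.+1 (ltnW kA')) (stepA k.+2 kA').
Qed.

(** Both bounds on [k] are kept, as the equality of the stopping steps is deduced from this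
    lemma. *)
Lemma run_ann k : (k <= kA)%N -> (k <= kB)%N ->
  \forall z \near z0, P k.+1 z = ann (E k z).
Proof.
have [_ E0 stepA _] := runA; have [_ P1 stepB _] := runB.
elim: k => [|k IH] kA' kB'.
  by apply: filterS2 E0 P1 => z -> ->; rewrite ann_span_du.
exact: (step_ann sf rf fz0 (run_regular (ltnW kA')) (IH (ltnW kA') (ltnW kB'))
  (stepA k.+1 kA') (stepB k.+1 kB')).
Qed.

(** Whichever run stops first makes the other meet its criterion at the same step. From A to B,
    equal dimensions give equal distributions only because of [run_mono]; from B to A, [ann] is
    injective. *)
Lemma run_stop : kA = kB.
Proof.
have [kA1 _ _ stopA] := runA; have [kB1 _ _ stopB] := runB.
case: (ltngtP kA kB) => // [AB|BA].
  apply: (stopB kA _).1; first by rewrite kA1 ltnW.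
  have := (stopA kA _).2 erefl; rewrite kA1 leqnn => /(_ isT) dE.
  have := run_ann (leqnn kA) (ltnW AB); have := run_ann (leq_pred kA) (leq_trans (leq_pred kA) (ltnW AB)).
  have := @run_mono kA.-1; rewrite prednK// leqnn => /(_ isT) mE annE' annE.
  apply: filterS3 annE annE' (filterI mE dE) => z -> -> [mEz dEz].
  by congr ann; apply/esym/eqP; rewrite eqEdim mEz dEz leqnn.
apply/esym; apply: (stopA kB _).1; first by rewrite kB1 ltnW.
have := (stopB kB _).2 erefl; rewrite kB1 leqnn => /(_ isT) PE.
have := run_ann (ltnW BA) (leqnn kB); have := run_ann (leq_trans (leq_pred kB) (ltnW BA)) (leq_pred kB).
rewrite prednK// => annE' annE.
by apply: filterS3 annE annE' PE => z -> -> /ann_inj ->.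
Qed.

End run.

Theorem theorem10 (R : realType) (n m : nat)
    (f : 'rV[R]_(n + m) -> 'rV[R]_n) (x0 : 'rV[R]_n) (u0 : 'rV[R]_m)
    (f_smooth : smooth_near (row_mx x0 u0) f)
    (f_rank : \forall z \near row_mx x0 u0, \rank ('J f z) = n)
    (f_equilibrium : f (row_mx x0 u0) = x0)
    (kA kB : nat) (E : nat -> tdistribution R (n + m))
    (P : nat -> codistribution R (n + m))
    (runA : algorithm_A f (row_mx x0 u0) kA E)
    (runB : algorithm_B f (row_mx x0 u0) kB P) :
  kA = kB /\
  forall k : nat, (1 <= k <= kA)%N ->
    \forall z \near row_mx x0 u0, P k z = ann (E k.-1 z).
Proof.
have fz0 : f (row_mx x0 u0) = lsubmx (row_mx x0 u0) by rewrite row_mxKl.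
have kAB := run_stop f_smooth f_rank fz0 runA runB; split=> // -[|k] //= kA'.
by apply: (run_ann f_smooth f_rank fz0 runA runB); rewrite -?kAB ltnW.
Qed.
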